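(* Assume that $\gamma<1$ and $\delta<1$. Then the following limit exists and is positive: $$\sigma^2=\lim_{n\to\infty}\boldsymbol{E}\big[|X_n-\boldsymbol{E}[X_n]|^2\big].$$ In addition, there exists a constant $C_{\alpha,\beta}>0$ depending on $\alpha$ and $\beta$ such that, as $n\to\infty$, $$\boldsymbol{E}\big[|S_n-\boldsymbol{E}[S_n]|^2\big]\sim\begin{cases}\frac{\sigma^2}{1-2\delta}\,n & \text{if }\delta<\frac12,\\ \sigma^2\,n\log n & \text{if }\delta=\frac12,\\ C_{\alpha,\beta}\,n^{2\delta} & \text{if }\frac12<\delta<1.\end{cases}$$
   Context: Setting. Let $d\ge 1$ and let $\mathcal{S}_{\mathfrak{e}},\mathcal{S}_{\mathfrak{o}},V_{\mathfrak{e}},V_{\mathfrak{o}}\subset\mathbf{R}^d$, with $V_{\mathfrak{o}},V_{\mathfrak{e}}$ finite, satisfy: (1) $x+v\in\mathcal{S}_{\mathfrak{o}}$ for $x\in\mathcal{S}_{\mathfrak{e}}$, $v\in V_{\mathfrak{o}}$; (2) $x+v\in\mathcal{S}_{\mathfrak{e}}$ for $x\in\mathcal{S}_{\mathfrak{o}}$, $v\in V_{\mathfrak{e}}$; (3) $V_{\mathfrak{o}}=-V_{\mathfrak{e}}$; (4) $0\in\mathcal{S}_{\mathfrak{e}}$; (5) $V_{\mathfrak{o}}\cap V_{\mathfrak{e}}=\emptyset$. Put $V=V_{\mathfrak{o}}\cup V_{\mathfrak{e}}$, let $m$ be the common cardinality of $V_{\mathfrak{o}}$ and $V_{\mathfrak{e}}$,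 and assume $m\ge2$. Fix $p,q\in[0,1]$ and set $\alpha=\frac{mp-1}{m-1}$, $\beta=\frac{mq-1}{m-1}$, $\gamma=\frac12(\alpha+\beta)$, $\delta=\frac12(\alpha-\beta)$. For each $k\ge2$ and $v\in V$ let $G_k(v)$ be a random variable with values in $V_{\mathfrak{o}}$ if $k$ is odd and in $V_{\mathfrak{e}}$ if $k$ is even, with the following law. Let $W$ denote $V_{\mathfrak{o}}$ if $k$ is odd and $V_{\mathfrak{e}}$ if $k$ is even, and let $w\in W$. If $v\in W$, then $\boldsymbol{P}(G_k(v)=w)=p$ for $w=v$ and $\frac{1-p}{m-1}$ for $w\ne v$. If $v\in V\setminus W$ (so $-v\in W$), then $\boldsymbol{P}(G_k(v)=w)=q$ for $w=-v$ and $\frac{1-q}{m-1}$ for $w\neq -v$. Let $X_1$ be uniform on $V_{\mathfrak{o}}$ and, for $n\ge1$, let $\mathcal{U}_n$ be uniform on $\{1,\dots,n\}$. The $\sigma$-fields $\sigma(X_1),\ \sigma(\mathcal{U}_1,\{G_2(v)\}_{v\in V}),\ \sigma(\mathcal{U}_2,\{G_3(v)\}_{v\in V}),\dots$ are independent, and for each $n\ge1$, $\mathcal{U}_n$ is independent of $\{G_{n+1}(v)\}_{v\in V}$. Define, for $n\geq 1$, $X_{n+1}=G_{n+1}(X_{\mathcal{U}_n})$; and $S_0=0$, $S_{n+1}=S_n+X_{n+1}$ for $n\ge0$ (the elephant random walk). Here $a_n\sim b_n$ means $a_n/b_n\to1$, and $|\cdot|$ is the Euclidean norm. The sets $V_{\mathfrak{o}},V_{\mathfrak{e}}$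 are fixed throughout; the constants $\sigma^2$ and $C_{\alpha,\beta}$ may also depend on them. *)

(* Defs.v *)
From HB Require Import structures.
From mathcomp Require Import all_boot all_order all_algebra finmap.
From mathcomp Require Import all_classical all_reals all_analysis.

Set Implicit Arguments.
Unset Strict Implicit.
Unset Printing Implicit Defensive.

Import Order.TTheory GRing.Theory Num.Theory numFieldNormedType.Exports.

Local Open Scope classical_set_scope.
Local Open Scope ring_scope.

(* The norm `| v | of the library on 'rV[R]_d is the sup norm. *)
Definition enorm (R : realType) (d : nat) (v : 'rV[R]_d) : R :=
  Num.sqrt (\sum_(i < d) v ord0 i ^+ 2).

Definition asymp_equiv (R : realType) (a b : nat -> R) : Prop :=
  (a n / b n) @[n --> \oo] --> (1 : R).

Section Probability.
Context (R : realType) (disp : measure_display) (T : measurableType disp)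
  (P : probability T R).

Definition mutually_independent (I : choiceType) (F : I -> set (set T)) : Prop :=
  forall (J : {fset I}) (A : I -> set T),
    (forall i, i \in J -> F i (A i)) ->
    P (\bigcap_(i in [set` J]) A i) = (\prod_(i <- J) P (A i))%E.

Definition independent2 (F1 F2 : set (set T)) : Prop :=
  forall A B, F1 A -> F2 B -> P (A `&` B) = (P A * P B)%E.

Context (d : nat).

Definition borel_rV : set (set 'rV[R]_d) := <<s open >>.

Definition sigma_vec (X : T -> 'rV[R]_d) : set (set T) :=
  preimage_set_system setT X borel_rV.

Definition sigma_nat (U : T -> nat) : set (set T) :=
  preimage_set_system setT U measurable.

Definition random_vector (X : T -> 'rV[R]_d) : Prop :=
  sigma_vec X `<=` measurable.

(* The vectors and real functions used below are bounded, so that their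
   expectations are finite and [fine] loses nothing. *)
Definition mean_vec (X : T -> 'rV[R]_d) : 'rV[R]_d :=
  \row_(i < d) fine 'E_P[fun w => X w ord0 i].

Definition mean_sq_dev (X : T -> 'rV[R]_d) : R :=
  fine 'E_P[fun w => enorm (X w - mean_vec X) ^+ 2].

End Probability.

Section Steps.
Context (R : realType) (d : nat).

Record step_system (Se So : set 'rV[R]_d) (Ve Vo : {fset 'rV[R]_d}) : Prop := {
  step_even_odd : forall x v, Se x -> v \in Vo -> So (x + v);
  step_odd_even : forall x v, So x -> v \in Ve -> Se (x + v);
  step_opp : Vo = [fset - v | v in Ve]%fset;
  step_origin : Se 0;
  step_disjoint : (Vo `&` Ve)%fset = fset0 }.

Lemma step_card Se So Ve Vo : step_system Se So Ve Vo -> #|` Ve| = #|` Vo|.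
Proof. by move=> h; rewrite (step_opp h) card_imfset //; exact: oppr_inj. Qed.

Definition steps_at (Ve Vo : {fset 'rV[R]_d}) (k : nat) : {fset 'rV[R]_d} :=
  if odd k then Vo else Ve.

End Steps.

Section Walk.
Context (R : realType) (d : nat) (Ve Vo : {fset 'rV[R]_d}) (p q : R).
Context (disp : measure_display) (T : measurableType disp)
  (P : probability T R).

Let m : nat := #|` Vo|.
Let V : {fset 'rV[R]_d} := (Vo `|` Ve)%fset.
Let W : nat -> {fset 'rV[R]_d} := steps_at Ve Vo.

Definition sigma_G (G : nat -> 'rV[R]_d -> T -> 'rV[R]_d) (k : nat) :
    set (set T) :=
  <<s \bigcup_(v in [set` V]) sigma_vec (G k v) >>.

(* Index 0 is sigma(X_1); index n >= 1 is sigma(U_n, {G_(n+1)(v)}_(v in V)). *)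
Definition driving_sigma (X : nat -> T -> 'rV[R]_d) (U : nat -> T -> nat)
    (G : nat -> 'rV[R]_d -> T -> 'rV[R]_d) (n : nat) : set (set T) :=
  if n is 0%N then sigma_vec (X 1%N)
  else <<s sigma_nat (U n) `|` sigma_G G n.+1 >>.

(* Only X n for n >= 1, U n for n >= 1, and G k v for k >= 2 and v in V are
   meaningful; the other values are unconstrained and never used. *)
Record elephant_steps (X : nat -> T -> 'rV[R]_d) (U : nat -> T -> nat)
    (G : nat -> 'rV[R]_d -> T -> 'rV[R]_d) : Prop := {
  first_random : random_vector (X 1%N);
  first_range : forall w, X 1%N w \in Vo;
  first_law : forall x, x \in Vo -> P [set w | X 1%N w = x] = (m%:R^-1)%:E;
  memory_random : forall n, (1 <= n)%N -> measurable_fun setT (U n);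
  memory_range : forall n, (1 <= n)%N -> forall w, (1 <= U n w <= n)%N;
  memory_law : forall n, (1 <= n)%N -> forall i, (1 <= i <= n)%N ->
    P [set w | U n w = i] = (n%:R^-1)%:E;
  response_random : forall k v, (2 <= k)%N -> v \in V -> random_vector (G k v);
  response_range : forall k v, (2 <= k)%N -> v \in V -> forall w, G k v w \in W k;
  response_law_same : forall k v x, (2 <= k)%N -> v \in V -> v \in W k ->
    x \in W k -> P [set w | G k v w = x] =
      (if x == v then p else (1 - p) / (m%:R - 1))%:E;
  response_law_opp : forall k v x, (2 <= k)%N -> v \in V -> v \notin W k ->
    x \in W k -> P [set w | G k v w = x] =
      (if x == - v then q else (1 - q) / (m%:R - 1))%:E;
  driving_independent : mutually_independent P (driving_sigma X U G);
  memory_response_independent : forall n, (1 <= n)%N ->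
    independent2 P (sigma_nat (U n)) (sigma_G G n.+1);
  step_rec : forall n, (1 <= n)%N -> forall w,
    X n.+1 w = G n.+1 (X (U n w) w) w }.

End Walk.

Fixpoint elephant_walk (R : realType) (d : nat) (T : Type)
    (X : nat -> T -> 'rV[R]_d) (n : nat) (w : T) : 'rV[R]_d :=
  if n is k.+1 then elephant_walk X k w + X k.+1 w else 0.

Definition memory_coef (R : realType) (m : nat) (p : R) : R :=
  (m%:R * p - 1) / (m%:R - 1).

(* Main.v *)
Require Import Defs.
From HB Require Import structures.
From mathcomp Require Import all_boot all_order all_algebra finmap.
From mathcomp Require Import all_classical all_reals all_analysis.
From mathcomp Require Import ring lra.

Set Implicit Arguments.
Unset Strict Implicit.
Unset Printing Implicit Defensive.

Import Order.TTheory GRing.Theory Num.Theory numFieldNormedType.Exports.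

Local Open Scope classical_set_scope.
Local Open Scope ring_scope.

(** Multiplying step k + 1 by (-1)^k folds every step back into Vo.  Given
    the past and the uniformly chosen index j < n, the law of the folded step Y n
    is gam + del (-1)^(n + j) times the point mass at Y j, plus the complementary
    multiple of the uniform law on Vo ([response_law], [recall_decomposition]).  The uniform law on Vo is therefore preserved: every
    Y n is uniform ([event_law]), E X_n is the signed barycentre of Vo, and
    E |X_n - E X_n|^2 is the variance of the uniform law for every n, which is
    positive because Vo has at least two points.

    Only joint laws of pairs of steps are needed for the walk.  The averaging
    mechanism gives cov k n = (1/n) sum_(j < n) (gam + del (-1)^(n + j)) cov k j
    for k < n ([cov_rec]).  Summing with signs, the second moments a of the centred
    walk, b of the sum of the centred folded steps, and their cross moment c
    satisfy a closed linear system ([moments_covariance_recursion]), in which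
      a (n + 1) = (1 + 2 del / n) a n + 2 gam (-1)^n c n / n + s2.
    The oscillating term is not small a priori, but it averages out:
    A n = a n + gam (-1)^n c n / n satisfies
      A (n + 1) = (1 + 2 del / n) A n + r n,
    where r n - s2 is O((|a| + |b| + |c|) / n^2 + 1 / n)
    ([corrected_source_bound]).  The moments are at most s2 n^2; a first pass
    through this recursion, using gam < 1 and del < 1, shows that they are o(n^2)
    ([moment_subquadratic], [cross_moment_subquadratic]).  Hence r n tends to s2
    and A n - a n = o(n), and the theorem is reduced to the scalar recurrence
      x (n + 1) = (1 + th / n) x n + r n,   r n tending to l > 0.

    Let rising n be the homogeneous solution.  Since
      (n + 1) / rising (n + 1) - n / rising n = (1 - th) / rising (n + 1),
    the Stolz-Cesaro theorem gives x n ~ l n / (1 - th) for th < 1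
    ([linear_growth]); for th = 1 it gives x n ~ l n ln n ([critical_growth]).
    For 1 < th < 2 the same identity shows that x n / rising n becomes monotone after
    adding suitable multiples of n / rising n, which tends to 0, and rising n is
    of order n^th ([supercritical_growth], [rising_powR]); the limit is positive
    because x n >= - o(n). *)

(** * Linear recurrences with an asymptotically constant source *)

Section Sequences.
Context {R : realType}.
Implicit Types (x y r u w : nat -> R) (s th l : R) (N n : nat).

(** The Stolz-Cesaro theorem.  The increments of u are given as multiples of
    those of w, so that w may be locally constant. *)
Lemma stolz_cesaro u w e l N :
  (forall n, (N <= n)%N -> w n <= w n.+1) ->
  (forall n, (N <= n)%N -> u n.+1 - u n = e n * (w n.+1 - w n)) ->
  w n @[n --> \oo] --> +oo -> e n @[n --> \oo] --> l ->
  u n / w n @[n --> \oo] --> l.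
Proof.
move=> w_nd du w_oo e_l; apply/cvgrPdist_le => eps eps0.
have eps20 : 0 < eps / 2 by lra.
move/cvgrPdist_le: e_l => /(_ _ eps20) [K _ Ke].
pose M := maxn N K.
pose v n := u n - l * w n.
have v_le n : (M <= n)%N -> `|v n - v M| <= eps / 2 * (w n - w M).
  elim: n => [|n IH]; first by rewrite leqn0 => /eqP <-; rewrite !subrr normr0 mulr0.
  rewrite leq_eqVlt ltnS => /predU1P[<-|Mn]; first by rewrite !subrr normr0 mulr0.
  have /andP[Nn Kn] : (N <= n)%N && (K <= n)%N by rewrite -geq_max.
  have dv : `|v n.+1 - v n| <= eps / 2 * (w n.+1 - w n).
    have -> : v n.+1 - v n = (e n - l) * (w n.+1 - w n).
      by rewrite /v mulrBl -du //; ring.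
    have dw : 0 <= w n.+1 - w n by rewrite subr_ge0 w_nd.
    by rewrite normrM (ger0_norm dw) ler_wpM2r // distrC; exact: Ke.
  have -> : v n.+1 - v M = (v n.+1 - v n) + (v n - v M) by ring.
  apply: (le_trans (ler_normD _ _)).
  by have := IH Mn; lra.
pose c := `|v M| + eps / 2 * `|w M|.
have c0 : 0 <= c by rewrite addr_ge0 // mulr_ge0 // ltW.
move/cvgryPge: w_oo => /(_ (1 + c / (eps / 2))) w_big.
near=> n.
have Mn : (M <= n)%N by near: n; exact: nbhs_infty_ge.
have wn : 1 + c / (eps / 2) <= w n by near: n.
have w0 : 0 < w n.
  by apply: lt_le_trans wn; rewrite ltr_pwDl // divr_ge0 // ltW.
have cw : c <= eps / 2 * w n.
  by rewrite mulrC -ler_pdivrMr //; apply: le_trans wn; rewrite lerDr.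
have -> : l - u n / w n = - (v n / w n).
  by rewrite /v; field; rewrite gt_eqF.
rewrite normrN normrM normfV (gtr0_norm w0) ler_pdivrMr //.
have := v_le _ Mn; have := ler_normD (v n - v M) (v M); rewrite subrK.
have := ler_norm (- w M); rewrite normrN.
have : 0 <= eps / 2 by lra.
move=> h1 h2 h3 h4.
have := ler_wpM2l h1 h2.
by move: cw; rewrite /c; lra.
Unshelve. all: by end_near. Qed.

Lemma cvg_ln_pinfty : ln (n%:R : R) @[n --> \oo] --> +oo.
Proof.
apply/cvgryPge => A; near=> n.
have n1 : expR A <= n%:R by near: n; exact: nbhs_infty_ger.
by rewrite -(expRK A) ler_ln ?posrE ?expR_gt0 // (lt_le_trans _ n1) ?expR_gt0.
Unshelve. all: by end_near. Qed.

Lemma ln_succ_sub n : (0 < n)%N ->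
  ln (n.+1%:R : R) - ln n%:R = ln (1 + n%:R^-1).
Proof.
move=> n0; have n0' : 0 < n%:R :> R by rewrite ltr0n.
rewrite -ln_div ?posrE ?ltr0n //; congr ln.
by rewrite -natr1; field; rewrite gt_eqF.
Qed.

(** Comparison with the logarithm, i.e. divergence of the harmonic series. *)
Lemma harmonic_growth_pinfty w (k : R) N : 0 < k ->
  (forall n, (N <= n)%N -> k / n.+1%:R <= w n.+1 - w n) ->
  w n @[n --> \oo] --> +oo.
Proof.
move=> k0 dw; pose c := w N.+1 - k * ln N.+2%:R.
have w_ge n : (N < n)%N -> c + k * ln n.+1%:R <= w n.
  elim: n => // n IH; rewrite ltnS leq_eqVlt => /predU1P[<-|Nn].
    by rewrite /c subrK.
  have ln_le : k * ln (1 + n.+1%:R^-1) <= k / n.+1%:R.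
    rewrite ler_pM2l //; apply: le_ln1Dx.
    by rewrite (lt_trans (ltrN10 _)) // invr_gt0 ltr0n.
  rewrite -ln_succ_sub // mulrBr in ln_le.
  move: (IH Nn) (le_trans ln_le (dw n (ltnW Nn))).
  by move: (k * ln _) (k * ln _) => a b; lra.
apply/cvgryPge => A.
move/cvgryPge: cvg_ln_pinfty => /(_ ((A - c) / k)) big.
near=> n.
have Nn : (N < n)%N by near: n; exact: nbhs_infty_gt.
have n0 : (0 < n)%N by exact: leq_ltn_trans Nn.
apply: le_trans (w_ge _ Nn).
have h : (A - c) / k <= ln (n.+1%:R : R).
  apply: (@le_trans _ _ (ln n%:R)); first by near: n.
  by rewrite ler_ln ?posrE ?ltr0n // ler_nat.
by move: h; rewrite ler_pdivrMr // mulrC; lra.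
Unshelve. all: by end_near. Qed.

(** The solution of the homogeneous recurrence; up to a constant factor it is
    the ratio Gamma (n + th) / Gamma n. *)
Definition rising th N n : R := \prod_(N <= i < n) (1 + th / i%:R).

Section Rising.
Variables (th : R) (N : nat).
Hypothesis N_gt0 : (0 < N)%N.
Hypothesis th_gtN : - N%:R < th.
Local Notation rs := (rising th N).

Let natN_gt0 n : (N <= n)%N -> 0 < n%:R :> R.
Proof. by move=> Nn; rewrite ltr0n (leq_trans N_gt0). Qed.

Let shift_gt0 n : (N <= n)%N -> 0 < n%:R + th.
Proof. by rewrite -(ler_nat R); move: th_gtN; lra. Qed.

Let factor_gt0 n : (N <= n)%N -> 0 < 1 + th / n%:R.
Proof.
move=> Nn; have n0 := natN_gt0 Nn.
have -> : 1 + th / n%:R = (n%:R + th) / n%:R by field; rewrite gt_eqF.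
by rewrite divr_gt0 // shift_gt0.
Qed.

Lemma rising_gt0 n : 0 < rs n.
Proof.
by rewrite /rising big_nat_cond prodr_gt0 // => i; rewrite andbT => /andP[/factor_gt0].
Qed.

Lemma risingS n : (N <= n)%N -> rs n.+1 = (1 + th / n%:R) * rs n.
Proof. by move=> Nn; rewrite /rising big_nat_recr //= mulrC. Qed.

(** This telescoping identity makes n / rising n the right scale against which
    to measure solutions with a constant source. *)
Lemma rising_telescope n : (N <= n)%N ->
  n.+1%:R / rs n.+1 - n%:R / rs n = (1 - th) / rs n.+1.
Proof.
move=> Nn; have n0 := natN_gt0 Nn; have f0 := shift_gt0 Nn.
have p0 := rising_gt0 n.
rewrite risingS // -natr1; field.
by rewrite !gt_eqF.
Qed.

Lemma rising_scale_pinfty : th < 1 -> n%:R / rs n @[n --> \oo] --> +oo.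
Proof.
move=> th1; pose w n := n%:R / rs n.
have wS n : (N <= n)%N -> w n <= w n.+1.
  by move=> Nn; rewrite -subr_ge0 rising_telescope // divr_ge0 ?ltW ?rising_gt0 ?subr_gt0.
have wN n : (N <= n)%N -> w N <= w n.
  elim: n => [|n IH]; first by rewrite leqn0 => /eqP->.
  rewrite leq_eqVlt ltnS => /predU1P[->//|Nn].
  exact: le_trans (IH Nn) (wS _ Nn).
have wN0 : 0 < w N by rewrite divr_gt0 ?rising_gt0 ?ltr0n.
apply: (@harmonic_growth_pinfty _ ((1 - th) * w N) N).
  by rewrite mulr_gt0 // subr_gt0.
move=> n Nn; rewrite rising_telescope // -mulrA ler_pM2l ?subr_gt0 //.
rewrite ler_pdivrMr ?ltr0n // mulrC; apply: wN; exact: leqW.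
Qed.

Section Solution.
Variables (x r : nat -> R).
Hypothesis x_rec : forall n, (N <= n)%N -> x n.+1 = (1 + th / n%:R) * x n + r n.

Lemma solution_increment n : (N <= n)%N ->
  x n.+1 / rs n.+1 - x n / rs n = r n / rs n.+1.
Proof.
move=> Nn; have n0 := natN_gt0 Nn; have f0 := shift_gt0 Nn.
have p0 := rising_gt0 n.
rewrite risingS // x_rec //; field.
by rewrite !gt_eqF.
Qed.

(** Both x / rising and n / rising have increments proportional to
    1 / rising (n + 1), with ratio r n / (1 - th); Stolz-Cesaro applies. *)
Lemma linear_growth l : th < 1 -> r n @[n --> \oo] --> l ->
  x n / n%:R @[n --> \oo] --> l / (1 - th).
Proof.
move=> th1 rl; have d0 : 0 < 1 - th by lra.
suff : (x n / rs n) / (n%:R / rs n) @[n --> \oo] --> l / (1 - th).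
  apply: cvg_trans; apply: near_eq_cvg; near=> n.
  have n0 : 0 < n%:R :> R by rewrite ltr0n; near: n; exact: nbhs_infty_gt.
  by field; rewrite !gt_eqF ?rising_gt0.
apply: (@stolz_cesaro _ _ (fun n => r n / (1 - th)) _ N).
- move=> n Nn; rewrite -subr_ge0 rising_telescope //.
  by rewrite divr_ge0 ?ltW ?rising_gt0.
- move=> n Nn; rewrite solution_increment // rising_telescope //.
  by field; rewrite !gt_eqF ?rising_gt0.
- exact: rising_scale_pinfty.
- by apply: cvgM => //; exact: cvg_cst.
Unshelve. all: by end_near. Qed.

End Solution.
End Rising.
End Sequences.

Section GrowthRates.
Context {R : realType}.
Implicit Types (x r : nat -> R) (s th l a : R) (N n : nat).

Lemma cvg_invn : (n%:R^-1 : R) @[n --> \oo] --> (0 : R).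
Proof. by rewrite -cvg_shiftS; exact: cvg_harmonic. Qed.

Lemma cvg_succ_ratio : (n.+1%:R / n%:R : R) @[n --> \oo] --> (1 : R).
Proof.
have : (1 + n%:R^-1 : R) @[n --> \oo] --> (1 + 0 : R).
  by apply: cvgD; [exact: cvg_cst|exact: cvg_invn].
rewrite addr0; apply: cvg_trans; apply: near_eq_cvg; near=> n.
have n0 : 0 < n%:R :> R by rewrite ltr0n; near: n; exact: nbhs_infty_gt.
by rewrite -natr1; field; rewrite gt_eqF.
Unshelve. all: by end_near. Qed.

(** Dividing x by n lowers the exponent th by one, which reduces this case to
    linear growth. *)
Lemma subquadratic_growth th N x r : (0 < N)%N -> - N%:R < th -> th < 2 ->
  (forall n, (N <= n)%N -> x n.+1 = (1 + th / n%:R) * x n + r n) ->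
  r n / n%:R @[n --> \oo] --> (0 : R) ->
  x n / n%:R ^+ 2 @[n --> \oo] --> (0 : R).
Proof.
move=> N0 thN th2 x_rec r0.
(* The shift of the index turns the factor (n + th) / (n + 1) into 1 + (th - 1) / k. *)
pose z k := x k.-1 / k.-1%:R.
have z_rec k : (N.+1 <= k)%N ->
    z k.+1 = (1 + (th - 1) / k%:R) * z k + r k.-1 / k%:R.
  case: k => // n; rewrite ltnS => Nn; rewrite /z /= x_rec //.
  have n0 : 0 < n%:R :> R by rewrite ltr0n (leq_trans N0).
  have n1 : n%:R + 1 != 0 :> R by rewrite gt_eqF // ltr_wpDr.
  by rewrite -natr1; field; rewrite n1 gt_eqF.
have thN1 : - N.+1%:R < th - 1 by rewrite -natr1; move: thN; lra.
have th1 : th - 1 < 1 by lra.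
have r'0 : r k.-1 / k%:R @[k --> \oo] --> (0 : R).
  rewrite -cvg_shiftS /=.
  have : (r n / n%:R) * (n.+1%:R / n%:R)^-1 @[n --> \oo] --> (0 * 1^-1 : R).
    by apply: cvgM => //; apply: cvgV; [exact: oner_neq0|exact: cvg_succ_ratio].
  rewrite mul0r; apply: cvg_trans; apply: near_eq_cvg; near=> n.
  have n0 : 0 < n%:R :> R by rewrite ltr0n; near: n; exact: nbhs_infty_gt.
  by field; rewrite !gt_eqF // ltr0n.
have := linear_growth (ltn0Sn N) thN1 z_rec th1 r'0.
rewrite mul0r -cvg_shiftS /= => z0.
have : (z n.+1 / n.+1%:R) * (n.+1%:R / n%:R) @[n --> \oo] --> (0 * 1 : R).
  by apply: cvgM z0 cvg_succ_ratio.
rewrite mul0r; apply: cvg_trans; apply: near_eq_cvg; near=> n.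
have n0 : 0 < n%:R :> R by rewrite ltr0n; near: n; exact: nbhs_infty_gt.
by rewrite /z /=; field; rewrite !gt_eqF // ltr0n.
Unshelve. all: by end_near. Qed.

(** Here x n / n has increments r n / (n + 1), asymptotic to those of l ln n. *)
Lemma critical_growth N x r l : (0 < N)%N ->
  (forall n, (N <= n)%N -> x n.+1 = (1 + n%:R^-1) * x n + r n) ->
  r n @[n --> \oo] --> l ->
  x n / (n%:R * ln n%:R) @[n --> \oo] --> l.
Proof.
move=> N0 x_rec rl.
have ln_bounds n : (0 < n)%N ->
    n.+1%:R^-1 <= ln (n.+1%:R : R) - ln n%:R <= n%:R^-1.
  move=> n0; have n0' : 0 < n%:R :> R by rewrite ltr0n.
  have n1' : 0 < n.+1%:R :> R by rewrite ltr0n.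
  apply/andP; split; last first.
    by rewrite ln_succ_sub // le_ln1Dx // (lt_trans (ltrN10 _)) ?invr_gt0.
  rewrite -opprB -ln_div ?posrE // lerNr.
  have -> : n%:R / n.+1%:R = 1 + - n.+1%:R^-1 :> R.
    by rewrite -natr1; field; rewrite natr1 gt_eqF.
  by apply: le_ln1Dx; rewrite ltrN2 invf_lt1 // ltr1n.
have ratio1 : n.+1%:R * (ln (n.+1%:R : R) - ln n%:R) @[n --> \oo] --> (1 : R).
  apply: (@squeeze_cvgr _ _ _ _ (fun=> 1) (fun n => n.+1%:R / n%:R)).
  - near=> n.
    have n0 : (0 < n)%N by near: n; exact: nbhs_infty_gt.
    have /andP[h1 h2] := ln_bounds _ n0.
    have n1' : 0 < n.+1%:R :> R by rewrite ltr0n.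
    by rewrite -ler_pdivrMl // mulr1 h1 ler_pM2l.
  - exact: cvg_cst.
  - exact: cvg_succ_ratio.
suff : (x n / n%:R) / ln n%:R @[n --> \oo] --> l.
  apply: cvg_trans; apply: near_eq_cvg; near=> n.
  by rewrite invfM mulrA.
apply: (@stolz_cesaro _ _ _
  (fun n => r n * (n.+1%:R * (ln n.+1%:R - ln n%:R))^-1) _ N).
- move=> n Nn; rewrite -subr_ge0.
  have /andP[h1 _] := ln_bounds _ (leq_trans N0 Nn).
  by rewrite (le_trans _ h1) // invr_ge0.
- move=> n Nn; have n0 := leq_trans N0 Nn.
  have /andP[h1 _] := ln_bounds _ n0.
  have n1' : 0 < n.+1%:R :> R by rewrite ltr0n.
  have d0 : 0 < ln (n.+1%:R : R) - ln n%:R by apply: lt_le_trans h1; rewrite invr_gt0.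
  rewrite invfM mulrA divfK ?gt_eqF // x_rec // -natr1.
  by field; rewrite !gt_eqF ?ltr0n // natr1 ltr0n.
- exact: cvg_ln_pinfty.
- rewrite -[l]mulr1 -[X in _ * X]invr1.
  by apply: cvgM => //; apply: cvgV => //; exact: oner_neq0.
Unshelve. all: by end_near. Qed.

Lemma ln_bernoulli s a : 0 <= s <= 1 -> 0 <= a ->
  s * ln (1 + a) <= ln (1 + s * a).
Proof.
move=> /andP[s0 s1] a0.
have a1 : 0 < 1 + a by rewrite ltr_wpDr.
have := @concave_ln R (Itv01 s0 s1) _ _ a1 ltr01.
rewrite !convRE /= ln1.
rewrite mulr0 addr0 mulrDr !mulr1.
by rewrite (_ : s + s * a + (1 - s) = 1 + s * a) //; ring.
Qed.

Lemma powR_succ_le s a : 0 <= s <= 1 -> 0 < a ->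
  (a + 1) `^ s <= (1 + s / a) * a `^ s.
Proof.
move=> s01 a0; have /andP[s0 s1] := s01.
have a1 : 0 <= a^-1 by rewrite invr_ge0 ltW.
have sa0 : 0 < 1 + s / a by rewrite ltr_wpDr // mulr_ge0.
have -> : a + 1 = (1 + a^-1) * a by field; rewrite gt_eqF.
rewrite powRM ?addr_ge0 // ?(ltW a0) // ler_wpM2r ?powR_ge0 //.
rewrite /powR gt_eqF ?ltr_wpDr //.
apply: (@le_trans _ _ (expR (ln (1 + s / a)))); last by rewrite lnK.
by rewrite ler_expR ln_bernoulli.
Qed.

Lemma powR_succ_ge s a : 1 <= s -> 0 < a ->
  (1 + s / a) * a `^ s <= (a + 1) `^ s.
Proof.
move=> s1 a0; have s0 : 0 < s by lra.
have a1 : 0 <= a^-1 by rewrite invr_ge0 ltW.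
have sa0 : 0 < 1 + s / a by rewrite ltr_wpDr // mulr_ge0 // ltW.
have -> : a + 1 = (1 + a^-1) * a by field; rewrite gt_eqF.
rewrite powRM ?addr_ge0 // ?(ltW a0) // ler_wpM2r ?powR_ge0 //.
rewrite /powR gt_eqF ?ltr_wpDr //.
apply: (@le_trans _ _ (expR (ln (1 + s / a)))); first by rewrite lnK.
rewrite ler_expR -ler_pdivrMl //.
have := @ln_bernoulli s^-1 (s / a).
rewrite mulKf ?gt_eqF //; apply; last by rewrite mulr_ge0 // ltW.
by rewrite invr_ge0 ltW //= invf_le1.
Qed.

(** The weight rising n / (n (n + 1)^(th - 1)) increases and
    rising n / n^th decreases, by Bernoulli's inequality; the two have the same limit. *)
Lemma rising_powR th N : (0 < N)%N -> 1 < th -> th < 2 ->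
  exists2 c : R, 0 < c & rising th N n / n%:R `^ th @[n --> \oo] --> c.
Proof.
move=> N0 th1 th2; pose s := th - 1.
have s01 : 0 <= s <= 1 by rewrite /s; lra.
have /andP[s0 s1] := s01.
have thN : - N%:R < th by rewrite (@le_lt_trans _ _ 0) ?oppr_le0 //; lra.
have rs0 := rising_gt0 N0 thN.
pose f n := rising th N n / n%:R `^ th.
pose g n := rising th N n / (n%:R * n.+1%:R `^ s).
have g_gt0 n : (0 < n)%N -> 0 < g n.
  by move=> n0; rewrite divr_gt0 // mulr_gt0 ?powR_gt0 ?ltr0n.
have gS n : (N <= n)%N -> g n <= g n.+1.
  move=> Nn; have n0 : 0 < n%:R :> R by rewrite ltr0n (leq_trans N0).
  have n1 : 0 < n.+1%:R :> R by rewrite ltr0n.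
  rewrite /g risingS // ler_pdivrMr ?mulr_gt0 ?powR_gt0 //.
  rewrite mulrAC ler_pdivlMr ?mulr_gt0 ?powR_gt0 ?ltr0n //.
  have := powR_succ_le s01 n1; rewrite natr1 => h.
  have : rising th N n * n.+1%:R * n.+2%:R `^ s <=
         rising th N n * n.+1%:R * ((1 + s / n.+1%:R) * n.+1%:R `^ s).
    by rewrite ler_pM2l // mulr_gt0.
  rewrite -[rising _ _ _ * _ * _ `^ s]mulrA; move/le_trans; apply.
  rewrite le_eqVlt; apply/orP; left; apply/eqP; rewrite /s -natr1.
  by field; rewrite natr1 !gt_eqF.
have g_nd n k : (N <= n)%N -> (n <= k)%N -> g n <= g k.
  move=> Nn; elim: k => [|k IH]; first by rewrite leqn0 => /eqP->.
  rewrite leq_eqVlt ltnS => /predU1P[->//|nk].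
  exact: le_trans (IH nk) (gS _ (leq_trans Nn nk)).
have fS n : (N <= n)%N -> f n.+1 <= f n.
  move=> Nn; have n0 : 0 < n%:R :> R by rewrite ltr0n (leq_trans N0).
  have n1 : 0 < n.+1%:R :> R by rewrite ltr0n.
  rewrite /f risingS // ler_pdivrMr ?powR_gt0 // mulrAC ler_pdivlMr ?powR_gt0 //.
  have := powR_succ_ge (ltW th1) n0; rewrite natr1 => h.
  by rewrite mulrAC mulrC ler_pM2l.
have f_le n : (N <= n)%N -> f n <= f N.
  elim: n => [|n IH]; first by rewrite leqn0 => /eqP->.
  rewrite leq_eqVlt ltnS => /predU1P[->//|nk].
  exact: le_trans (fS _ nk) (IH nk).
have fg n : (0 < n)%N -> f n = g n * (n.+1%:R / n%:R) `^ s.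
  move=> n0; have n0' : 0 < n%:R :> R by rewrite ltr0n.
  have r0 : 0 < n.+1%:R / n%:R :> R by rewrite divr_gt0 // ltr0n.
  have nS : n.+1%:R `^ s = (n.+1%:R / n%:R) `^ s * n%:R `^ s :> R.
    by rewrite -powRM ?divfK ?gt_eqF // ltW.
  rewrite /f /g nS; move: (n.+1%:R / n%:R) r0 => rho r0.
  have -> : n%:R `^ th = n%:R * n%:R `^ s :> R.
    by rewrite /s mulr_powRB1 //; lra.
  by field; rewrite !gt_eqF ?powR_gt0 ?ltr0n.
have ratio1 : (n.+1%:R / n%:R : R) `^ s @[n --> \oo] --> (1 : R).
  apply: (@squeeze_cvgr _ _ _ _ (fun=> 1) (fun n => n.+1%:R / n%:R)).
  - near=> n.
    have n0 : (0 < n)%N by near: n; exact: nbhs_infty_gt.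
    have n0' : 0 < n%:R :> R by rewrite ltr0n.
    have r1 : 1 <= n.+1%:R / n%:R :> R by rewrite ler_pdivlMr // mul1r ler_nat.
    rewrite ler1_powR // andbT.
    by have := @ler_powR _ _ r1 _ _ s0; rewrite powRr0.
  - exact: cvg_cst.
  - exact: cvg_succ_ratio.
have gcvg : cvgn g.
  apply: (@near_nondecreasing_is_cvgn _ _ (f N)).
    by exists N => // n Nn k nk; exact: g_nd.
  near=> n; have Nn : (N <= n)%N by near: n; exact: nbhs_infty_ge.
  have n0 := leq_trans N0 Nn.
  apply: le_trans (f_le _ Nn); rewrite fg // ler_pMr ?g_gt0 //.
  have n0' : 0 < n%:R :> R by rewrite ltr0n.
  have r1 : 1 <= n.+1%:R / n%:R :> R by rewrite ler_pdivlMr // mul1r ler_nat.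
  by have := @ler_powR _ _ r1 _ _ s0; rewrite powRr0.
exists (limn g).
  apply: (@lt_le_trans _ _ (g N)); first exact: g_gt0.
  apply: limr_ge => //; near=> n; apply: g_nd => //.
  by near: n; exact: nbhs_infty_ge.
rewrite -[limn g]mulr1.
have : g n * (n.+1%:R / n%:R) `^ s @[n --> \oo] --> limn g * 1.
  by apply: cvgM.
apply: cvg_trans; apply: near_eq_cvg; near=> n; rewrite -fg //.
by near: n; exact: nbhs_infty_gt.
Unshelve. all: by end_near. Qed.
End GrowthRates.

Section Supercritical.
Context {R : realType}.
Implicit Types (x y r f : nat -> R) (s th l : R) (N n : nat).

Lemma cvg_powR_pinfty s : 0 < s -> (n%:R : R) `^ s @[n --> \oo] --> +oo.
Proof.
move=> s0; apply/cvgryPge => A.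
move/cvgryPge: (@cvg_ln_pinfty R) => /(_ (A / s)) big.
near=> n.
have n0 : (0 < n)%N by near: n; exact: nbhs_infty_gt.
have : A / s <= ln (n%:R : R) by near: n.
rewrite ler_pdivrMr // /powR pnatr_eq0 gtn_eqF // mulrC => h.
by apply: (le_trans h); apply: le_trans (expR_ge1Dx _); rewrite lerDr.
Unshelve. all: by end_near. Qed.

(** Divided by rising th N n, the solution becomes increasing or decreasing after
    adding suitable multiples of n / rising th N n, which tends to 0.  The
    increasing sequence is positive at some n by the hypothesis on y, and then so
    is its limit. *)
Lemma supercritical_growth th N x r y l : (0 < N)%N -> 1 < th -> th < 2 ->
  (forall n, (N <= n)%N -> x n.+1 = (1 + th / n%:R) * x n + r n) ->
  0 < l -> r n @[n --> \oo] --> l ->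
  (forall n, (N <= n)%N -> - y n <= x n) ->
  y n / n%:R @[n --> \oo] --> (0 : R) ->
  exists2 C : R, 0 < C & x n / n%:R `^ th @[n --> \oo] --> C.
Proof.
move=> N0 th1 th2 x_rec l0 rl yx y0.
have thN : - N%:R < th by rewrite (@le_lt_trans _ _ 0) ?oppr_le0 //; lra.
have s0 : 0 < th - 1 by lra.
have rs0 := rising_gt0 N0 thN.
have [c c0 rc] := rising_powR N0 th1 th2.
pose w n := n%:R / rising th N n.
pose u n := x n / rising th N n.
have w0 : w n @[n --> \oo] --> (0 : R).
  have h : (n%:R `^ (th - 1))^-1 @[n --> \oo] --> (0 : R).
    apply/gtr0_cvgV0; last exact: cvg_powR_pinfty.
    by near=> n; rewrite powR_gt0 // ltr0n; near: n; exact: nbhs_infty_gt.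
  have : (n%:R `^ (th - 1))^-1 / (rising th N n / n%:R `^ th)
      @[n --> \oo] --> (0 / c : R).
    by apply: cvgM => //; apply: cvgV => //; rewrite gt_eqF.
  rewrite mul0r; apply: cvg_trans; apply: near_eq_cvg; near=> n.
  have n0 : 0 < n%:R :> R by rewrite ltr0n; near: n; exact: nbhs_infty_gt.
  rewrite /w -[n%:R `^ th]mulr_powRB1 ?ltW //; last by lra.
  by field; rewrite !gt_eqF ?powR_gt0.
(* By the telescoping identity, u + k w increases at n when k (th - 1) <= r n and
   decreases when k (th - 1) >= r n; k1 and k2 serve for l / 2 <= r n <= 2 l. *)
pose k1 := (l / 2) / (th - 1); pose k2 := (2 * l) / (th - 1).
have k10 : 0 < k1 by rewrite !divr_gt0.
have [K _ Kr] : \forall n \near \oo, l / 2 <= r n <= 2 * l.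
  near=> n; apply/andP; split; near: n.
    by apply: (cvgr_ge _ rl); lra.
  by apply: (cvgr_le _ rl); lra.
have [K' _ Ky] : \forall n \near \oo, y n / n%:R <= k1 / 2.
  by apply: (cvgr_le _ y0); rewrite divr_gt0.
pose M := maxn N (maxn K K').
have MN n : (M <= n)%N -> [&& N <= n, K <= n & K' <= n]%N.
  by rewrite !geq_max.
have incr k n : (M <= n)%N ->
    u n.+1 + k * w n.+1 - (u n + k * w n) = (r n - k * (th - 1)) / rising th N n.+1.
  move=> /MN /and3P[Nn _ _].
  have := solution_increment N0 thN x_rec Nn.
  have := rising_telescope N0 thN Nn.
  rewrite -/(u n) -/(u n.+1) -/(w n) -/(w n.+1) => h1 h2.
  have -> : u n.+1 + k * w n.+1 - (u n + k * w n) =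
    (u n.+1 - u n) + k * (w n.+1 - w n) by ring.
  by rewrite h1 h2; ring.
have k1E : k1 * (th - 1) = l / 2 by rewrite divfK ?gt_eqF.
have k2E : k2 * (th - 1) = 2 * l by rewrite divfK ?gt_eqF.
pose q n := u n + k1 * w n; pose p n := u n + k2 * w n.
have qS n : (M <= n)%N -> q n <= q n.+1.
  move=> Mn; have /and3P[_ /Kr /= /andP[h _] _] := MN _ Mn.
  by rewrite -subr_ge0 incr // k1E divr_ge0 ?subr_ge0 // ltW.
have pS n : (M <= n)%N -> p n.+1 <= p n.
  move=> Mn; have /and3P[_ /Kr /= /andP[_ h] _] := MN _ Mn.
  rewrite -subr_le0 incr // k2E mulr_le0_ge0 ?subr_le0 //.
  by rewrite invr_ge0 ltW.
have q_nd n k : (M <= n)%N -> (n <= k)%N -> q n <= q k.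
  move=> Mn; elim: k => [|k IH]; first by rewrite leqn0 => /eqP->.
  rewrite leq_eqVlt ltnS => /predU1P[->//|nk].
  exact: le_trans (IH nk) (qS _ (leq_trans Mn nk)).
have p_le n : (M <= n)%N -> p n <= p M.
  elim: n => [|n IH]; first by rewrite leqn0 => /eqP->.
  rewrite leq_eqVlt ltnS => /predU1P[->//|nk].
  exact: le_trans (pS _ nk) (IH nk).
have qcvg : cvgn q.
  apply: (@near_nondecreasing_is_cvgn _ _ (p M)).
    by exists M => // n Mn k nk; exact: q_nd.
  exists M => // n /= Mn; apply: le_trans (p_le _ Mn).
  rewrite lerD2l ler_wpM2r ?divr_ge0 // ?ltW //.
  by rewrite ltr_pM2r ?invr_gt0 //; lra.
have limq0 : 0 < limn q.
  have /MN/and3P[NM _ K'M] := leqnn M.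
  have M0 : 0 < M%:R :> R by rewrite ltr0n (leq_trans N0).
  apply: (@lt_le_trans _ _ (q M)); last first.
    by apply: limr_ge => //; exists M => // n /=; exact: q_nd.
  rewrite /q /u /w mulrA -mulrDl divr_gt0 //.
  have := Ky _ K'M; rewrite /= ler_pdivrMr // => h.
  have := yx _ NM; have := mulr_gt0 k10 M0.
  by move: h; rewrite mulrAC; lra.
have u_lim : u n @[n --> \oo] --> limn q.
  have : q n - k1 * w n @[n --> \oo] --> limn q - k1 * 0.
    by apply: cvgB => //; apply: cvgM => //; exact: cvg_cst.
  rewrite mulr0 subr0; apply: cvg_trans; apply: near_eq_cvg; near=> n.
  by rewrite /q addrK.
exists (limn q * c); first exact: mulr_gt0.
have : u n * (rising th N n / n%:R `^ th) @[n --> \oo] --> limn q * c.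
  exact: cvgM.
apply: cvg_trans; apply: near_eq_cvg; near=> n.
by rewrite /u mulrA divfK // gt_eqF.
Unshelve. all: by end_near. Qed.

(** * The covariance recursion *)

(** The recursion satisfied by the second moments of the centred walk (a) and of
    the sum of the centred folded steps (b), and by their cross moment (c). *)
Definition covariance_recursion (gam del s2 : R) (a b c : nat -> R) : Prop :=
  [/\ a 1%N = s2, b 1%N = s2, c 1%N = s2 &
  forall n, (0 < n)%N -> [/\
    a n.+1 = (1 + 2 * del / n%:R) * a n + 2 * gam * (-1) ^+ n * (c n / n%:R) + s2,
    b n.+1 = (1 + 2 * gam / n%:R) * b n + 2 * del * (-1) ^+ n * (c n / n%:R) + s2 &
    c n.+1 = (1 + (gam + del) / n%:R) * c n
             + (-1) ^+ n * (del * a n / n%:R + gam * b n / n%:R + s2)]].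

Lemma covariance_recursion_swap gam del s2 a b c :
  covariance_recursion gam del s2 a b c -> covariance_recursion del gam s2 b a c.
Proof.
move=> [a1 b1 c1 rec]; split=> // n n0.
have [an bn cn] := rec _ n0; split=> //.
by rewrite cn [del + gam]addrC [gam * b n / _ + _]addrC.
Qed.

Section Recursion.
Variables (gam del s2 : R) (a b c : nat -> R).
Hypothesis s2_ge0 : 0 <= s2.
Hypothesis coef_le1 : `|gam| + `|del| <= 1.
Hypothesis abc_rec : covariance_recursion gam del s2 a b c.

Let normS n (z : R) : `|(-1) ^+ n * z| = `|z|.
Proof. by rewrite normrM normrX normrN1 expr1n mul1r. Qed.

(** The coefficients of order 1 / n in each line add up to at most 2 in absolute
    value, and n^2 + 2 n + 1 = (n + 1)^2. *)
Lemma covariance_recursion_bound n : (0 < n)%N ->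
  [/\ `|a n| <= s2 * n%:R ^+ 2, `|b n| <= s2 * n%:R ^+ 2 & `|c n| <= s2 * n%:R ^+ 2].
Proof.
have [a1 b1 c1 rec] := abc_rec.
elim: n => // n IH _.
have [->|n0] := posnP n; first by rewrite a1 b1 c1 expr1n mulr1 ger0_norm.
have [IHa IHb IHc] := IH n0; have [-> -> ->] := rec _ n0.
have n0' : 0 < n%:R :> R by rewrite ltr0n.
pose B := s2 * n%:R; have B0 : 0 <= B by rewrite mulr_ge0 // ltW.
have B2 : s2 * n%:R ^+ 2 = B * n%:R by rewrite expr2 mulrA.
have goal (u v z t k1 k2 k3 : R) : `|k1| + `|k2| + `|k3| <= 2 ->
    `|u| <= s2 * n%:R ^+ 2 -> `|v| <= s2 * n%:R ^+ 2 -> `|z| <= s2 * n%:R ^+ 2 ->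
    `|t| <= s2 ->
  `|u + k1 * (u / n%:R) + k2 * (v / n%:R) + k3 * (z / n%:R) + t| <= s2 * n.+1%:R ^+ 2.
  move=> k_le hu hv hz ht.
  have part (k y : R) : `|y| <= s2 * n%:R ^+ 2 -> `|k * (y / n%:R)| <= `|k| * B.
    move=> hy; rewrite normrM ler_wpM2l // normrM normfV (gtr0_norm n0').
    by rewrite ler_pdivrMr // -B2.
  have sum_le : (`|k1| + `|k2| + `|k3|) * B <= 2 * B by rewrite ler_wpM2r.
  have -> : s2 * n.+1%:R ^+ 2 = s2 * n%:R ^+ 2 + 2 * B + s2.
    by rewrite -natr1 /B; ring.
  apply: le_trans (ler_normD _ _) _; apply: lerD => //.
  apply: le_trans (ler_normD _ _) _; apply: (le_trans (lerD _ (part k3 _ hz))).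
    apply: le_trans (ler_normD _ _) _; apply: (lerD _ (part k2 _ hv)).
    by apply: le_trans (ler_normD _ _) _; apply: (lerD hu (part k1 _ hu)).
  by move: sum_le; rewrite !mulrDl; lra.
have norm2 (k : R) : `|2 * k| = 2 * `|k| by rewrite normrM ger0_norm.
have s2s : `|s2| <= s2 by rewrite ger0_norm.
split.
- have := @goal (a n) ((-1) ^+ n * c n) 0 s2 (2 * del) (2 * gam) 0.
  rewrite normr0 addr0 !norm2 normS => /(_ _ IHa IHc _ s2s).
  have -> : a n + 2 * del * (a n / n%:R) + 2 * gam * ((-1) ^+ n * c n / n%:R) +
    0 * (0 / n%:R) + s2 = (1 + 2 * del / n%:R) * a n +
    2 * gam * (-1) ^+ n * (c n / n%:R) + s2 by ring.
  by apply; [move: coef_le1; lra|rewrite mulr_ge0 // sqr_ge0].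
- have := @goal (b n) ((-1) ^+ n * c n) 0 s2 (2 * gam) (2 * del) 0.
  rewrite normr0 addr0 !norm2 normS => /(_ _ IHb IHc _ s2s).
  have -> : b n + 2 * gam * (b n / n%:R) + 2 * del * ((-1) ^+ n * c n / n%:R) +
    0 * (0 / n%:R) + s2 = (1 + 2 * gam / n%:R) * b n +
    2 * del * (-1) ^+ n * (c n / n%:R) + s2 by ring.
  by apply; [move: coef_le1; lra|rewrite mulr_ge0 // sqr_ge0].
- have := @goal (c n) ((-1) ^+ n * a n) ((-1) ^+ n * b n) ((-1) ^+ n * s2)
    (gam + del) del gam.
  rewrite !normS => /(_ _ IHc IHa IHb s2s).
  have -> : c n + (gam + del) * (c n / n%:R) + del * ((-1) ^+ n * a n / n%:R) +
    gam * ((-1) ^+ n * b n / n%:R) + (-1) ^+ n * s2 = (1 + (gam + del) / n%:R) * c n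
             + (-1) ^+ n * (del * a n / n%:R + gam * b n / n%:R + s2) by ring.
  by apply; have := ler_normD gam del; move: coef_le1; lra.
Qed.

(** Adding this multiple of the cross moment cancels, up to lower order, the
    term of alternating sign in the recursion for a. *)
Definition corrected n : R := a n + gam * (-1) ^+ n * (c n / n%:R).

Definition corrected_source n : R :=
  corrected n.+1 - (1 + 2 * del / n%:R) * corrected n.

(** Because (-1)^n changes sign, the increment of (-1)^n c n / n is minus twice
    itself up to terms of the order of the bound; the correction is chosen so that
    it absorbs exactly the oscillating term. *)
Lemma corrected_source_bound n : (0 < n)%N ->
  `|corrected_source n - s2| <=
  5 * ((`|a n| + `|b n| + `|c n|) / n%:R ^+ 2) + s2 / n%:R.
Proof.
move=> n0; have n0' : 0 < n%:R :> R by rewrite ltr0n.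
have n1' : 0 < n.+1%:R :> R by rewrite ltr0n.
have [_ _ _ rec] := abc_rec; have [an _ cn] := rec _ n0.
have sq1 : (-1) ^+ n * (-1) ^+ n = 1 :> R by rewrite -expr2 sqrr_sign.
pose i : R := n%:R^-1; pose j : R := n.+1%:R^-1.
have i0 : 0 <= i by rewrite invr_ge0 ltW.
have j0 : 0 <= j by rewrite invr_ge0 ltW.
have ji : j <= i by rewrite lef_pV2 ?posrE // ler_nat.
have ij : i - j = i * j.
  by rewrite /i /j -natr1; field; rewrite natr1 !gt_eqF.
pose t1 := (1 - gam - del) * (c n * (i * j)).
pose t2 := - (2 * del * (c n * i ^+ 2)).
pose t3 := - (del * (a n * (i * j))).
pose t4 := - (gam * (b n * (i * j))).
pose t5 := - (s2 * j).
have -> : corrected_source n - s2 =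
    gam * ((-1) ^+ n * t1 + (-1) ^+ n * t2 + t3 + t4 + t5).
  rewrite /corrected_source /corrected an cn exprS -/i -/j.
  rewrite /t1 /t2 /t3 /t4 /t5.
  set e := (-1) ^+ n in sq1 *.
  have -> : gam * (-1 * e) * (((1 + (gam + del) * i) * c n +
      e * (del * a n * i + gam * b n * i + s2)) * j) =
    - (gam * e * ((1 + (gam + del) * i) * c n * j)
      + gam * (e * e) * ((del * a n * i + gam * b n * i + s2) * j)) by ring.
  rewrite sq1.
  have -> : gam * e * ((1 + (gam + del) * i) * c n * j) =
    gam * e * (c n * (i - i * j)  + (gam + del) * (c n * (i * j))).
    by have -> : i - i * j = j by [rewrite -ij; ring]; ring.
  by ring.
have g1 : `|gam| <= 1 by have := normr_ge0 del; move: coef_le1; lra.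
have d1 : `|del| <= 1 by have := normr_ge0 gam; move: coef_le1; lra.
rewrite normrM.
apply: (@le_trans _ _ `|(-1) ^+ n * t1 + (-1) ^+ n * t2 + t3 + t4 + t5|).
  by rewrite ler_piMl.
have iji : i * j <= i ^+ 2 by rewrite expr2 ler_wpM2l.
have ij0 : 0 <= i * j by rewrite mulr_ge0.
have part (k z h : R) : 0 <= h <= i ^+ 2 -> `|k * (z * h)| <= `|k| * (`|z| * i ^+ 2).
  move=> /andP[h0 hi]; rewrite !normrM (ger0_norm h0) ler_wpM2l //.
  by rewrite ler_wpM2l.
have ijP : 0 <= i * j <= i ^+ 2 by rewrite ij0.
have iiP : 0 <= i ^+ 2 <= i ^+ 2 by rewrite sqr_ge0 lexx.
have mono (k K z : R) : `|k| <= K -> `|k| * (`|z| * i ^+ 2) <= K * (`|z| * i ^+ 2).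
  by move=> ?; rewrite ler_wpM2r // mulr_ge0 // sqr_ge0.
have b1 : `|t1| <= 3 * (`|c n| * i ^+ 2).
  apply: (le_trans (part _ _ _ ijP)); apply: mono.
  have := ler_normB (1 - gam) del; have := ler_normB 1 gam.
  by rewrite normr1; lra.
have b2 : `|t2| <= 2 * (`|c n| * i ^+ 2).
  rewrite normrN; apply: (le_trans (part _ _ _ iiP)); apply: mono.
  by rewrite normrM ger0_norm //; lra.
have b3 : `|t3| <= 1 * (`|a n| * i ^+ 2).
  by rewrite normrN; apply: (le_trans (part _ _ _ ijP)); apply: mono.
have b4 : `|t4| <= 1 * (`|b n| * i ^+ 2).
  by rewrite normrN; apply: (le_trans (part _ _ _ ijP)); apply: mono.
have b5 : `|t5| <= s2 * i.
  by rewrite normrN normrM ger0_norm // ger0_norm // ler_wpM2l.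
have := ler_normD ((-1) ^+ n * t1 + (-1) ^+ n * t2 + t3 + t4) t5.
have := ler_normD ((-1) ^+ n * t1 + (-1) ^+ n * t2 + t3) t4.
have := ler_normD ((-1) ^+ n * t1 + (-1) ^+ n * t2) t3.
have := ler_normD ((-1) ^+ n * t1) ((-1) ^+ n * t2).
rewrite !normS -exprVn -/i !mulrDl.
have : 0 <= `|a n| * i ^+ 2 by rewrite mulr_ge0 // sqr_ge0.
have : 0 <= `|b n| * i ^+ 2 by rewrite mulr_ge0 // sqr_ge0.
move: b1 b2 b3 b4 b5; move: (_ * i ^+ 2) (_ * i ^+ 2) (_ * i ^+ 2) (s2 * i).
by move=> *; lra.
Qed.

End Recursion.
End Supercritical.

Section Asymptotics.
Context {R : realType}.
Implicit Types (f g a b c : nat -> R).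

Lemma cvg0_norm_le f g : (forall n, (0 < n)%N -> `|f n| <= g n) ->
  g n @[n --> \oo] --> (0 : R) -> f n @[n --> \oo] --> (0 : R).
Proof.
move=> fg g0; apply: (@squeeze_cvgr _ _ _ _ (fun n => - g n) g) => //.
  near=> n; rewrite -ler_norml; apply: fg.
  by near: n; exact: nbhs_infty_gt.
by rewrite -oppr0; exact: cvgN.
Unshelve. all: by end_near. Qed.

Lemma cvg_cst_div (k : R) : k / n%:R @[n --> \oo] --> (0 : R).
Proof.
by rewrite -[X in _ --> X](mulr0 k); apply: cvgM; [exact: cvg_cst|exact: cvg_invn].
Qed.

Lemma corrected_dist (gam : R) a c n : `|gam| <= 1 -> (0 < n)%N ->
  `|corrected gam a c n - a n| <= `|c n| / n%:R.
Proof.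
move=> gam_le1 n0; rewrite /corrected addrC addKr -mulrA normrM.
apply: (@le_trans _ _ `|(-1) ^+ n * (c n / n%:R)|); first by rewrite ler_piMl.
by rewrite normrM normrX normrN1 expr1n mul1r normrM normfV normr_nat.
Qed.

Section AnyDrift.
Variables (gam del s2 : R) (a b c : nat -> R).
Hypothesis s2_ge0 : 0 <= s2.
Hypothesis coef_le1 : `|gam| + `|del| <= 1.
Hypothesis abc_rec : covariance_recursion gam del s2 a b c.
Let gam_le1 : `|gam| <= 1.
Proof. by have := normr_ge0 del; move: coef_le1; lra. Qed.
Let del_le1 : `|del| <= 1.
Proof. by have := normr_ge0 gam; move: coef_le1; lra. Qed.

Lemma corrected_recursion n :
  corrected gam a c n.+1 = (1 + 2 * del / n%:R) * corrected gam a c n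
                           + corrected_source gam del a c n.
Proof. by rewrite /corrected_source addrC subrK. Qed.

(** The trivial bound s2 n^2 makes the source of the corrected recursion bounded,
    which already forces growth slower than n^2. *)
Lemma moment_subquadratic : del < 1 -> a n / n%:R ^+ 2 @[n --> \oo] --> (0 : R).
Proof.
move=> del1.
have bounds := covariance_recursion_bound s2_ge0 coef_le1 abc_rec.
have src : corrected_source gam del a c n / n%:R @[n --> \oo] --> (0 : R).
  apply: (cvg0_norm_le _ (cvg_cst_div (17 * s2))) => n n0.
  have n0' : 0 < n%:R :> R by rewrite ltr0n.
  have n1 : 1 <= n%:R :> R by rewrite ler1n.
  rewrite normrM normfV (gtr0_norm n0') ler_wpM2r ?invr_ge0 //.
  have [ha hb hc] := bounds _ n0.
  have := corrected_source_bound s2_ge0 coef_le1 abc_rec n0.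
  have : (`|a n| + `|b n| + `|c n|) / n%:R ^+ 2 <= 3 * s2.
    by rewrite ler_pdivrMr ?exprn_gt0 //; lra.
  have : s2 / n%:R <= s2 by rewrite ler_pdivrMr // ler_peMr.
  have := ler_normD (corrected_source gam del a c n - s2) s2.
  by rewrite subrK (ger0_norm s2_ge0); lra.
have del2 : 2 * del < 2 by lra.
have delN : - 3%:R < 2 * del.
  by have := ler_norm (- del); rewrite normrN; move: del_le1; lra.
(* The recurrence is used from n = 3 on, where |2 del| <= 2 makes 1 + 2 del / n > 0. *)
have A0 := @subquadratic_growth R (2 * del) 3 (corrected gam a c)
  (corrected_source gam del a c) isT delN del2 (fun n _ => corrected_recursion n) src.
have d0 : (corrected gam a c n - a n) / n%:R ^+ 2 @[n --> \oo] --> (0 : R).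
  apply: (cvg0_norm_le _ (cvg_cst_div s2)) => n n0.
  have n0' : 0 < n%:R :> R by rewrite ltr0n.
  rewrite normrM normfV (ger0_norm (sqr_ge0 _)) ler_pdivrMr ?exprn_gt0 //.
  have [_ _ hc] := bounds _ n0.
  apply: (le_trans (corrected_dist a c gam_le1 n0)); rewrite ler_pdivrMr //.
  by apply: (le_trans hc); rewrite le_eqVlt; apply/orP; left; apply/eqP; field; rewrite gt_eqF.
rewrite -[X in _ --> X]subr0.
have : corrected gam a c n / n%:R ^+ 2 - (corrected gam a c n - a n) / n%:R ^+ 2
    @[n --> \oo] --> (0 - 0 : R) by exact: cvgB.
by under eq_fun do rewrite -mulrBl subKr.
Unshelve. all: by end_near. Qed.

Lemma cross_moment_subquadratic : gam < 1 -> del < 1 ->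
  a n / n%:R ^+ 2 @[n --> \oo] --> (0 : R) ->
  b n / n%:R ^+ 2 @[n --> \oo] --> (0 : R) ->
  c n / n%:R ^+ 2 @[n --> \oo] --> (0 : R).
Proof.
move=> gam1 del1 a0 b0.
have [_ _ _ rec] := abc_rec.
have gdN : - 3%:R < gam + del.
  have := ler_norm (- del); have := ler_norm (- gam); rewrite !normrN.
  by move: gam_le1 del_le1; lra.
have gd2 : gam + del < 2 by lra.
pose r n := (-1) ^+ n * (del * a n / n%:R + gam * b n / n%:R + s2).
apply: (@subquadratic_growth R (gam + del) 3 c r) => //.
  by move=> n n3; have [_ _ ->] := rec n (leq_trans (isT : 0 < 3)%N n3).
have f0 : `|del * (a n / n%:R ^+ 2) + gam * (b n / n%:R ^+ 2) + s2 / n%:R|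
    @[n --> \oo] --> (0 : R).
  rewrite -(normr0 R); apply: cvg_norm.
  have -> : 0 = del * 0 + gam * 0 + 0 :> R by ring.
  apply: cvgD; last exact: cvg_cst_div.
  by apply: cvgD; apply: cvgM => //; exact: cvg_cst.
apply: (cvg0_norm_le _ f0) => n n0.
have n0' : n%:R != 0 :> R by rewrite pnatr_eq0 -lt0n.
rewrite /r 2!normrM normrX normrN1 expr1n mul1r -normrM le_eqVlt.
by apply/orP; left; apply/eqP; congr `|_|; field.
Qed.

End AnyDrift.

(** The correction is of order c n / n = o(n), hence invisible at every scale
    at least linear. *)
Lemma corrected_transfer (gam : R) a c f (L : R) :
  `|gam| <= 1 -> c n / n%:R ^+ 2 @[n --> \oo] --> (0 : R) ->
  (\forall n \near \oo, n%:R <= f n) ->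
  corrected gam a c n / f n @[n --> \oo] --> L -> a n / f n @[n --> \oo] --> L.
Proof.
move=> g1 c0 [K _ Kf] AL.
have d0 : (corrected gam a c n - a n) / f n @[n --> \oo] --> (0 : R).
  have c0' : `|c n / n%:R ^+ 2| @[n --> \oo] --> (0 : R).
    by rewrite -(normr0 R); exact: cvg_norm.
  apply: (@squeeze_cvgr _ _ _ _ (fun n => - `|c n / n%:R ^+ 2|)
    (fun n => `|c n / n%:R ^+ 2|)) => //.
    near=> n; rewrite -ler_norml.
    have n0 : (0 < n)%N by near: n; exact: nbhs_infty_gt.
    have n0' : 0 < n%:R :> R by rewrite ltr0n.
    have nf : n%:R <= f n by apply: Kf => /=; near: n; exact: nbhs_infty_ge.
    have f0 : 0 < f n by exact: lt_le_trans nf.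
    rewrite !normrM !normfV (gtr0_norm f0) ler_pdivrMr //.
    apply: (le_trans (corrected_dist a c g1 n0)).
    have -> : `|c n| / n%:R = `|c n| / `|n%:R ^+ 2| * n%:R.
      by rewrite (ger0_norm (sqr_ge0 _)); field; rewrite gt_eqF.
    by rewrite ler_wpM2l // mulr_ge0 // invr_ge0.
  by rewrite -oppr0; exact: cvgN.
rewrite -[X in _ --> X]subr0.
have : corrected gam a c n / f n - (corrected gam a c n - a n) / f n
    @[n --> \oo] --> (L - 0 : R) by exact: cvgB.
by under eq_fun do rewrite -mulrBl subKr.
Unshelve. all: by end_near. Qed.

Section Trichotomy.
Variables (gam del s2 : R) (a b c : nat -> R).
Hypothesis s2_gt0 : 0 < s2.
Hypothesis coef_le1 : `|gam| + `|del| <= 1.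
Hypothesis abc_rec : covariance_recursion gam del s2 a b c.
Hypotheses (gam_lt1 : gam < 1) (del_lt1 : del < 1).
Let s2_ge0 := ltW s2_gt0.
Let gam_le1 : `|gam| <= 1.
Proof. by have := normr_ge0 del; move: coef_le1; lra. Qed.
Let A := corrected gam a c.
Let src := corrected_source gam del a c.
Let del2N : - 3%:R < 2 * del.
Proof.
by have := ler_norm (- del); have := normr_ge0 gam; rewrite normrN; move: coef_le1; lra.
Qed.

Let a0 : a n / n%:R ^+ 2 @[n --> \oo] --> (0 : R).
Proof. exact: (moment_subquadratic s2_ge0 coef_le1 abc_rec). Qed.

Let b0 : b n / n%:R ^+ 2 @[n --> \oo] --> (0 : R).
Proof.
apply: (moment_subquadratic s2_ge0 _ (covariance_recursion_swap abc_rec)) => //.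
by rewrite addrC.
Qed.

Let c0 : c n / n%:R ^+ 2 @[n --> \oo] --> (0 : R).
Proof. exact: (cross_moment_subquadratic coef_le1 abc_rec). Qed.

Let src_cvg : src n @[n --> \oo] --> s2.
Proof.
suff : src n - s2 @[n --> \oo] --> (0 : R).
  move=> h; rewrite -[s2]add0r.
  have : src n - s2 + s2 @[n --> \oo] --> (0 + s2 : R).
    by apply: cvgD => //; exact: cvg_cst.
  by under eq_fun do rewrite subrK.
have norm0 f : f n @[n --> \oo] --> (0 : R) -> `|f n| @[n --> \oo] --> (0 : R).
  by move=> f0; rewrite -(normr0 R); exact: cvg_norm.
have b_0 : 5 * (`|a n / n%:R ^+ 2| + `|b n / n%:R ^+ 2| + `|c n / n%:R ^+ 2|)
    + s2 / n%:R @[n --> \oo] --> (5 * (0 + 0 + 0) + 0 : R).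
  apply: cvgD; last exact: cvg_cst_div.
  apply: cvgM; first exact: cvg_cst.
  by apply: cvgD; [apply: cvgD|]; apply: norm0.
rewrite !addr0 mulr0 in b_0.
apply: (cvg0_norm_le _ b_0) => n n0.
apply: (le_trans (corrected_source_bound s2_ge0 coef_le1 abc_rec n0)).
by rewrite !normrM !normfV (ger0_norm (sqr_ge0 _)) !mulrDl.
Unshelve. all: by end_near. Qed.

Lemma moment_linear : del < 1 / 2 -> a n / n%:R @[n --> \oo] --> s2 / (1 - 2 * del).
Proof.
move=> del12; apply: (corrected_transfer gam_le1 c0); first by near=> n.
have th1 : 2 * del < 1 by lra.
exact: (@linear_growth R (2 * del) 3 isT del2N A src
  (fun n _ => corrected_recursion gam del a c n) _ th1 src_cvg).
Unshelve. all: by end_near. Qed.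

Lemma moment_critical : del = 1 / 2 -> a n / (n%:R * ln n%:R) @[n --> \oo] --> s2.
Proof.
move=> del12; apply: (corrected_transfer gam_le1 c0).
  near=> n; apply: ler_peMr => //.
  by near: n; move/cvgryPge: (@cvg_ln_pinfty R); exact.
apply: (@critical_growth R 1 A src s2) => // n _.
by rewrite /A (corrected_recursion gam del a c n) (_ : 2 * del = 1) ?mul1r //; lra.
Unshelve. all: by end_near. Qed.

Lemma moment_supercritical : (forall n, 0 <= a n) -> 1 / 2 < del ->
  exists2 C : R, 0 < C & a n / n%:R `^ (2 * del) @[n --> \oo] --> C.
Proof.
move=> age0 del12.
have th1 : 1 < 2 * del by lra.
have th2 : 2 * del < 2 by move: del_lt1; lra.
have [||C C0 AC] := @supercritical_growth R (2 * del) 3 A src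
  (fun n => `|c n| / n%:R) s2 isT th1 th2
  (fun n _ => corrected_recursion gam del a c n) s2_gt0 src_cvg.
- move=> n n3; have n0 : (0 < n)%N by exact: leq_trans n3.
  have := corrected_dist a c gam_le1 n0; have := age0 n.
  by rewrite ler_norml => ? /andP[h _]; rewrite /A; lra.
- have c0' : `|c n / n%:R ^+ 2| @[n --> \oo] --> (0 : R).
    by rewrite -(normr0 R); exact: cvg_norm.
  apply: (cvg0_norm_le _ c0') => n n0.
  rewrite !normrM !normfV !normr_id !normr_nat (ger0_norm (sqr_ge0 _)).
  by rewrite -mulrA -invfM -expr2.
exists C => //; apply: (corrected_transfer gam_le1 c0) AC.
near=> n; apply: le1r_powR; last exact: ltW.
by rewrite ler1n; near: n; exact: nbhs_infty_gt.
Unshelve. all: by end_near. Qed.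

End Trichotomy.
End Asymptotics.

(** * Finite expectations and total probability *)

Section Expectation.
Context {R : realType} {disp : measure_display} {T : measurableType disp}.
Variable P : probability T R.
Implicit Types (f g : T -> R) (A B E : set T).

Definition pr A : R := fine (P A).

Lemma prE A : measurable A -> P A = (pr A)%:E.
Proof. by move=> mA; rewrite /pr fineK // fin_num_measure. Qed.

Definition has_mean f (x : R) : Prop :=
  P.-integrable setT (EFin \o f) /\ ('E_P[f])%E = x%:E.

Lemma has_mean_ext f g x : f =1 g -> has_mean f x -> has_mean g x.
Proof. by move=> /funext ->. Qed.

Lemma has_mean_indic A : measurable A -> has_mean \1_A (pr A).
Proof.
move=> mA; split; first exact: integrable_indic.
by rewrite expectation_indic // prE.
Qed.

Lemma has_mean_cst (k : R) : has_mean (fun=> k) k.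
Proof.
split; last exact: expectation_cst.
exact: finite_measure_integrable_cst.
Qed.

Lemma has_meanZ k f x : has_mean f x -> has_mean (fun w => k * f w) (k * x).
Proof.
move=> [fi fx]; split; first exact: (integrableZl measurableT k fi).
have -> : (fun w => k * f w) = k \o* f by apply/funext => w; rewrite /= mulrC.
by rewrite expectationZl ?fx //; exact/Lfun1_integrable.
Qed.

Lemma has_meanD f g x y : has_mean f x -> has_mean g y ->
  has_mean (fun w => f w + g w) (x + y).
Proof.
move=> [fi fx] [gi gy]; split; first exact: (integrableD measurableT fi gi).
by rewrite (expectationD (X := f) (Y := g)) ?fx ?gy //; exact/Lfun1_integrable.
Qed.

Lemma has_mean_sum (I : eqType) (s : seq I) (f : I -> T -> R) (x : I -> R) :
  (forall i, i \in s -> has_mean (f i) (x i)) ->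
  has_mean (fun w => \sum_(i <- s) f i w) (\sum_(i <- s) x i).
Proof.
elim: s => [_|i s IH fx].
  rewrite big_nil; apply: has_mean_ext (has_mean_cst 0) => w.
  by rewrite big_nil.
rewrite big_cons; apply: (@has_mean_ext (fun w => f i w + \sum_(j <- s) f j w)).
  by move=> w; rewrite big_cons.
apply: has_meanD; first by apply: fx; rewrite mem_head.
by apply: IH => j js; apply: fx; rewrite in_cons js orbT.
Qed.

Lemma has_mean_unique f x y : has_mean f x -> has_mean f y -> x = y.
Proof. by move=> [_ fx] [_ fy]; move: fy; rewrite fx => -[]. Qed.

(** The indicator of A is the sum of the indicators of the pieces cut out by the
    fibres of h, and expectation is linear. *)
Lemma total_probability (I : eqType) (s : seq I) (h : T -> I) A :
  uniq s -> (forall w, h w \in s) -> measurable A ->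
  (forall i, i \in s -> measurable (A `&` [set w | h w = i])) ->
  pr A = \sum_(i <- s) pr (A `&` [set w | h w = i]).
Proof.
move=> us hs mA mAi; apply: (has_mean_unique (has_mean_indic mA)).
apply: has_mean_ext (has_mean_sum (fun i si => has_mean_indic (mAi i si))) => w.
rewrite (bigD1_seq (h w)) //= big1 ?addr0 => [|i hi].
  by rewrite !indicE in_setI [X in _ && X]mem_set // andbT.
by rewrite indicE in_setI [X in _ && X]memNset ?andbF //= => hwi; rewrite hwi eqxx in hi.
Qed.

Lemma measurable_fibres (I : eqType) (s : seq I) (h : T -> I) A :
  (forall w, h w \in s) ->
  (forall i, i \in s -> measurable (A `&` [set w | h w = i])) -> measurable A.
Proof.
move=> hs mA.
have -> : A = \bigcup_(i in [set` s]) (A `&` [set w | h w = i]).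
  apply/seteqP; split=> w /=; last by move=> [i _ []].
  by move=> Aw; exists (h w) => //=; exact: hs.
by apply: fin_bigcup_measurable; [exact: finite_seq|exact: mA].
Qed.

(** * Independence of the past *)

Section Past.
Variable F : nat -> set (set T).
Hypothesis F_meas : forall n, F n `<=` measurable.
Hypothesis F_indep : mutually_independent P F.

(** The event E is independent of all future sources F i, i >= n.  Defining the
    past by this property, which passes to finite partitions and to
    intersections with events of F n, spares the generated sigma-algebras. *)
Definition past n E : Prop := measurable E /\
  forall (J : {fset nat}) (A : nat -> set T),
    (forall i, i \in J -> (n <= i)%N /\ F i (A i)) ->
    pr (E `&` \bigcap_(i in [set` J]) A i) = pr E * \prod_(i <- J) pr (A i).

Let meas_bigcap (J : {fset nat}) (A : nat -> set T) :
  (forall i, i \in J -> F i (A i)) -> measurable (\bigcap_(i in [set` J]) A i).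
Proof.
move=> FA; rewrite bigcap_fset big_seq.
by apply: bigsetI_measurable => i iJ; exact: F_meas (FA i iJ).
Qed.

Lemma past0 : past 0 setT.
Proof.
split=> // J A FA; have FA' i : i \in J -> F i (A i) by move=> /FA[].
rewrite setTI /pr probability_setT mul1r F_indep //.
suff : (\prod_(i <- J) P (A i))%E = (\prod_(i <- J) pr (A i))%:E by move=> ->.
rewrite (big_morph EFin (@EFinM R) erefl) big_seq [RHS]big_seq; apply: eq_bigr => i /FA' /F_meas.
exact: prE.
Qed.

Lemma past_set0 n : past n set0.
Proof. by split=> // J A _; rewrite set0I /pr measure0 mul0r. Qed.

Lemma pastW n k E : (n <= k)%N -> past n E -> past k E.
Proof.
move=> nk [mE IE]; split=> // J A FA; apply: IE => i /FA [ki ?].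
by split=> //; exact: leq_trans ki.
Qed.

(** A future event at times > n, intersected with B, is a future event at times >= n. *)
Lemma pastI n E B : past n E -> F n B ->
  past n.+1 (E `&` B) /\ pr (E `&` B) = pr E * pr B.
Proof.
move=> [mE IE] FB; have mB := F_meas FB.
have prEB : pr (E `&` B) = pr E * pr B.
  have := IE [fset n]%fset (fun=> B); rewrite set_fset1 bigcap_set1 big_seq_fset1.
  by apply=> i; rewrite inE => /eqP->.
split=> //; split=> [|J A FA]; first exact: measurableI.
have nJ : n \notin J by apply/negP => /FA[]; rewrite ltnn.
pose A' i := if i == n then B else A i.
have A'J i : i \in J -> A' i = A i.
  by move=> iJ; rewrite /A'; case: eqP => // ein; rewrite -ein iJ in nJ.
have := IE (n |` J)%fset A'.
have A'n : A' n = B by rewrite /A' eqxx.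
rewrite bigcap_fsetU1 big_fsetU1 //= A'n setIA mulrA -prEB.
rewrite (eq_big_seq (fun i => pr (A i))); last by move=> i /A'J ->.
have -> : \bigcap_(i in [set` J]) A' i = \bigcap_(i in [set` J]) A i.
  by apply: eq_bigcapr => i /= /A'J.
apply=> i; rewrite in_fset1U => /predU1P[->|iJ]; first by rewrite A'n.
by rewrite A'J //; have [/ltnW ? ?] := FA _ iJ.
Qed.

Lemma past_partition n (I : eqType) (s : seq I) (h : T -> I) E :
  uniq s -> (forall w, h w \in s) ->
  (forall i, i \in s -> past n (E `&` [set w | h w = i])) -> past n E.
Proof.
move=> us hs Ei; have mEi i : i \in s -> measurable (E `&` [set w | h w = i]).
  by move=> /Ei[].
have mE := measurable_fibres hs mEi; split=> // J A FA.
set C := \bigcap_(i in _) _.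
have mC : measurable C by apply: meas_bigcap => i /FA[].
have mECi i : i \in s -> measurable ((E `&` C) `&` [set w | h w = i]).
  by move=> si; rewrite setIAC; apply: measurableI => //; exact: mEi.
rewrite (total_probability us hs (measurableI _ _ mE mC) mECi).
rewrite (total_probability us hs mE mEi) mulr_suml.
apply: eq_big_seq => i si; rewrite setIAC.
by have [_] := Ei i si; apply.
Qed.

End Past.
End Expectation.

(** * The law of the walk *)

Section Law.
Variables (R : realType) (d : nat) (Se So : set 'rV[R]_d) (Ve Vo : {fset 'rV[R]_d}).
Variables (p q : R) (disp : measure_display) (T : measurableType disp).
Variables (P : probability T R) (X : nat -> T -> 'rV[R]_d) (U : nat -> T -> nat).
Variable G : nat -> 'rV[R]_d -> T -> 'rV[R]_d.
Hypothesis steps : step_system Se So Ve Vo.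
Hypothesis m_ge2 : (2 <= #|` Vo|)%N.
Hypothesis walk : elephant_steps Ve Vo p q P X U G.

Local Notation m := (#|` Vo|).
Local Notation pr := (pr P).
Local Notation sgn k := ((-1) ^+ k : R).

Definition gam : R := (memory_coef m p + memory_coef m q) / 2.
Definition del : R := (memory_coef m p - memory_coef m q) / 2.

Lemma sgn_scaleK k : involutive (fun v : 'rV[R]_d => sgn k *: v).
Proof. by move=> v; rewrite scalerA -expr2 sqrr_sign scale1r. Qed.

Lemma memVe v : (v \in Ve) = (- v \in Vo).
Proof.
rewrite (step_opp steps); apply/idP/imfsetP => [vV|[u uV /oppr_inj ->] //].
by exists v.
Qed.

Lemma memVo_sgn k v : v \in Vo -> sgn k *: v \in steps_at Ve Vo k.+1.
Proof.
move=> vV; rewrite -signr_odd /steps_at /=; case: (odd k); last by rewrite scale1r.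
by rewrite expr1 scaleN1r memVe opprK.
Qed.

Lemma mem_steps_at k x : x \in steps_at Ve Vo k.+1 -> sgn k *: x \in Vo.
Proof.
rewrite -signr_odd /steps_at /=; case: (odd k) => /=; last by rewrite scale1r.
by rewrite expr1 scaleN1r memVe.
Qed.

Lemma steps_at_V k x : x \in steps_at Ve Vo k -> x \in (Vo `|` Ve)%fset.
Proof. by rewrite /steps_at in_fsetU; case: odd => ->; rewrite ?orbT. Qed.

Lemma step_range k w : X k.+1 w \in steps_at Ve Vo k.+1.
Proof.
elim/ltn_ind: k => k IH; case: k IH => [|k] IH; first exact: (first_range walk).
rewrite (step_rec walk) //; apply: (response_range walk) => //.
have /andP[] := memory_range walk (ltn0Sn k) w.
by case: (U _ _) => // j _ jk; apply: (steps_at_V (IH j _)).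
Qed.

(** Folding the steps into Vo by the parity sign makes the law of the next step
    depend on parity only through the weight kap below. *)
Definition Y k w : 'rV[R]_d := sgn k *: X k.+1 w.

Definition event k y : set T := [set w | Y k w = y].

Lemma Y_range k w : Y k w \in Vo.
Proof. exact: mem_steps_at (step_range k w). Qed.

Lemma XY k w : X k.+1 w = sgn k *: Y k w.
Proof. by rewrite /Y sgn_scaleK. Qed.

Lemma borel_set1 (x : 'rV[R]_d) : borel_rV [set x].
Proof.
rewrite -[[set x]]setCK -setTD.
have [_ + _] := smallest_sigma_algebra setT (@open 'rV[R]_d); apply.
apply: sub_sigma_algebra; rewrite openC.
exact/accessible_closed_set1/hausdorff_accessible/norm_hausdorff.
Qed.

Lemma sigma_vec1 (Z : T -> 'rV[R]_d) x : sigma_vec Z [set w | Z w = x].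
Proof. by exists [set x]; [exact: borel_set1|rewrite setTI]. Qed.

Lemma sigma_nat1 (N : T -> nat) k : sigma_nat N [set w | N w = k].
Proof. by exists [set k]; rewrite ?setTI. Qed.

Lemma sigma_G1 k v x : v \in (Vo `|` Ve)%fset ->
  sigma_G Ve Vo G k [set w | G k v w = x].
Proof.
by move=> vV; apply: sub_sigma_algebra; exists v => //; exact: sigma_vec1.
Qed.

Local Notation F := (driving_sigma Ve Vo X U G).

Lemma driving_measurable n : F n `<=` measurable.
Proof.
case: n => [|n]; first exact: (first_random walk).
apply: smallest_sub; first exact: sigma_algebra_measurable.
move=> A [[B mB <-]|]; first exact: (memory_random walk).
move: A; apply: smallest_sub; first exact: sigma_algebra_measurable.
by move=> A [v vV]; exact: (response_random walk).
Qed.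

Let F_indep := driving_independent walk.

(** The event of the n-th source under which the folded step v, recalled from
    index j, produces the folded step y at index n. *)
Definition recall n j v y : set T :=
  [set w | U n w = j.+1] `&` [set w | G n.+1 (sgn j *: v) w = sgn n *: y].

Lemma recall_driving n j v y : (0 < n)%N -> v \in Vo -> F n (recall n j v y).
Proof.
case: n => // n _ vV.
pose gen := sigma_nat (U n.+1) `|` sigma_G Ve Vo G n.+2.
apply: (@measurableI _ (g_sigma_algebraType gen)); apply: sub_sigma_algebra.
  by left; exact: sigma_nat1.
by right; apply: sigma_G1; exact: steps_at_V (memVo_sgn j vV).
Qed.

(** The weight, possibly negative, of repetition in the law of a folded step given
    the recalled one; the rest of the law is uniform. *)
Definition kap n j : R := gam + del * (sgn n * sgn j).

Lemma kapE n j : kap n j = memory_coef m (if odd n == odd j then p else q).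
Proof.
rewrite /kap /gam /del -(signr_odd _ n) -(signr_odd _ j).
by case: (odd n); case: (odd j) => /=; rewrite ?expr1 ?expr0; field.
Qed.

Let m0 : 0 < m%:R :> R.
Proof. by rewrite ltr0n (leq_trans _ m_ge2). Qed.
Let m1 : 0 < m%:R - 1 :> R.
Proof. by rewrite subr_gt0 ltr1n. Qed.

Lemma memory_coef_same (r : R) :
  memory_coef m r + (1 - memory_coef m r) / m%:R = r.
Proof. by rewrite /memory_coef; field; rewrite !gt_eqF. Qed.

Lemma memory_coef_other (r : R) :
  (1 - memory_coef m r) / m%:R = (1 - r) / (m%:R - 1).
Proof. by rewrite /memory_coef; field; rewrite !gt_eqF. Qed.

Lemma response_law n j v y : (0 < n)%N -> v \in Vo -> y \in Vo ->
  pr [set w | G n.+1 (sgn j *: v) w = sgn n *: y] =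
  kap n j * (y == v)%:R + (1 - kap n j) / m%:R.
Proof.
move=> n0 vV yV; rewrite kapE.
have jV := steps_at_V (memVo_sgn j vV).
have yW := memVo_sgn n yV.
have inj_s k : injective (fun u : 'rV[R]_d => sgn k *: u) := inv_inj (sgn_scaleK k).
have final (r : R) (b : bool) : (if b then r else (1 - r) / (m%:R - 1)) =
    memory_coef m r * b%:R + (1 - memory_coef m r) / m%:R.
  case: b; first by rewrite mulr1 memory_coef_same.
  by rewrite mulr0 add0r memory_coef_other.
have sgnE a b : odd a = odd b -> sgn a = sgn b by move=> h; rewrite -signr_odd h signr_odd.
have [nj|nj] := eqVneq (odd n) (odd j).
  have vW : sgn j *: v \in steps_at Ve Vo n.+1.
    by rewrite -(sgnE _ _ nj); exact: memVo_sgn.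
  rewrite /pr (response_law_same walk) //= -final; congr (if _ then _ else _).
  by rewrite -(sgnE _ _ nj) (inj_eq (@inj_s n)).
have sgn_opp : sgn n = - sgn j.
  rewrite -(signr_odd _ n) -(signr_odd _ j).
  by case: (odd n) (odd j) nj => [] [] //=; rewrite ?expr1 ?expr0 ?opprK.
have vW : sgn j *: v \notin steps_at Ve Vo n.+1.
  apply/negP => /mem_steps_at; rewrite sgn_opp scaleNr sgn_scaleK => NvV.
  have : v \in (Vo `&` Ve)%fset by rewrite in_fsetI vV memVe.
  by rewrite (step_disjoint steps).
rewrite /pr (response_law_opp walk) //= -final; congr (if _ then _ else _).
by rewrite sgn_opp scaleNr eqr_opp (inj_eq (@inj_s j)).
Qed.

Lemma recall_law n j v y : (j < n)%N -> v \in Vo -> y \in Vo ->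
  pr (recall n j v y) = n%:R^-1 * (kap n j * (y == v)%:R + (1 - kap n j) / m%:R).
Proof.
move=> jn vV yV; have n0 : (0 < n)%N := leq_ltn_trans (leq0n j) jn.
rewrite -response_law // /pr /recall.
have jV := steps_at_V (memVo_sgn j vV).
rewrite (memory_response_independent walk n0) ?(memory_law walk) //.
- rewrite prE ?fineM //.
  exact: (response_random walk (n0 : (2 <= n.+1)%N) jV (sigma_vec1 _ _)).
- exact: sigma_nat1.
- exact: sigma_G1.
Qed.

(** The pair formed by the recalled index and the recalled folded step takes
    finitely many values; on each of its fibres the event splits into a past
    event and an event of the n-th source.  With E = setT this yields the law of
    Y n, with E an event of an earlier step it yields joint laws. *)
Lemma recall_decomposition n E y : (0 < n)%N -> y \in Vo ->
  (forall j v, (j < n)%N -> v \in Vo -> past P F n (E `&` event j v)) ->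
  past P F n.+1 (E `&` event n y) /\
  pr (E `&` event n y) = n%:R^-1 * \sum_(j < n) \sum_(v <- Vo)
    pr (E `&` event j v) * (kap n j * (y == v)%:R + (1 - kap n j) / m%:R).
Proof.
move=> n0 yV Ej.
pose h w := ((U n w).-1, Y (U n w).-1 w).
pose s := [seq (j, v) | j <- iota 0 n, v <- enum_fset Vo].
have us : uniq s by apply: allpairs_uniq; rewrite ?iota_uniq ?fset_uniq // => -[? ?] [].
have Un w : (U n w = (U n w).-1.+1) /\ ((U n w).-1 < n)%N.
  by have /andP[] := memory_range walk n0 w; case: (U n w).
have hs w : h w \in s.
  apply/allpairsP; exists (h w); rewrite mem_iota /= add0n.
  by have [_ ->] := Un w; rewrite Y_range.
have fibre j v : (E `&` event n y) `&` [set w | h w = (j, v)] =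
    (E `&` event j v) `&` recall n j v y.
  apply/seteqP; split=> w /=.
    move=> [[Ew Yw] [Uj Yj]]; have [UE _] := Un w.
    rewrite Uj in UE Yj; split=> //; split=> //=.
    rewrite -Yw /Y sgn_scaleK (step_rec walk) // UE; congr (G _ _ _).
    by rewrite XY Yj.
  move=> [[Ew Yj] [Uj Gw]]; split; last by rewrite /h Uj /= Yj.
  by split=> //; rewrite /event /= /Y (step_rec walk) // Uj XY Yj Gw sgn_scaleK.
have fibre_past i : i \in s -> past P F n.+1 (E `&` event n y `&` [set w | h w = i]) /\
    pr (E `&` event n y `&` [set w | h w = i]) =
    n%:R^-1 * (pr (E `&` event i.1 i.2) *
      (kap n i.1 * (y == i.2)%:R + (1 - kap n i.1) / m%:R)).
  move=> /allpairsP[[j v] [/=]]; rewrite mem_iota /= add0n => jn vV -> /=.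
  rewrite fibre.
  have [h1 h2] := pastI driving_measurable (Ej _ _ jn vV) (recall_driving j y n0 vV).
  by split=> //; rewrite h2 recall_law // mulrCA.
have En : past P F n.+1 (E `&` event n y).
  by apply: (past_partition driving_measurable us hs) => i /fibre_past [].
split=> //; rewrite (total_probability P us hs) //; first last.
- by move=> i /fibre_past [[]].
- by have [] := En.
rewrite (eq_big_seq _ (fun i si => (fibre_past i si).2)) -mulr_sumr; congr (_ * _).
rewrite /s big_allpairs_dep /=.
by rewrite -(subn0 n) -/(index_iota 0 n) big_mkord subn0.
Qed.

Lemma event0_past x : past P F 1 (event 0 x).
Proof.
have := pastI driving_measurable (past0 driving_measurable F_indep) (sigma_vec1 (X 1) x).
rewrite setTI => -[+ _]; rewrite (_ : [set w | _] = event 0 x) //.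
by apply/seteqP; split=> w; rewrite /event /= /Y expr0 scale1r.
Qed.

Lemma event_disjoint k x v : x != v -> event k x `&` event k v = set0.
Proof.
move=> xv; apply/seteqP; split=> w //= [Yx Yv]; move: xv.
by rewrite -Yx -Yv eqxx.
Qed.

(** The partition by the recalled step propagates independence of the future
    from pairs of earlier steps to pairs containing the new one. *)
Lemma events_past n k j x v : (k < n)%N -> (j < n)%N -> x \in Vo -> v \in Vo ->
  past P F n (event k x `&` event j v).
Proof.
elim: n k j x v => // n IH k j x v.
have diag k' : (forall y, y \in Vo -> past P F n.+1 (event k' y)) ->
    x \in Vo -> v \in Vo -> past P F n.+1 (event k' x `&` event k' v).
  move=> pk xV vV; have [<-|xv] := eqVneq x v; first by rewrite setIid; exact: pk.
  by rewrite event_disjoint //; exact: past_set0.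
have [n_0|n0] := posnP n.
  rewrite n_0 in diag *.
  by rewrite !ltnS !leqn0 => /eqP-> /eqP-> xV vV; apply: diag => // y _; exact: event0_past.
have new E y : y \in Vo ->
    (forall j' v', (j' < n)%N -> v' \in Vo -> past P F n (E `&` event j' v')) ->
    past P F n.+1 (E `&` event n y).
  by move=> yV Ej; have [] := recall_decomposition n0 yV Ej.
rewrite !ltnS leq_eqVlt => /predU1P[->|kn]; rewrite leq_eqVlt => /predU1P[->|jn] xV vV.
- apply: diag => // y yV; rewrite -[event n y]setTI; apply: new => // j' v' jn' vV'.
  by rewrite setTI -[event j' v']setIid; exact: IH.
- by rewrite setIC; apply: new => // j' v' jn' vV'; exact: IH.
- by apply: new => // j' v' jn' vV'; exact: IH.
- by apply: pastW (leqnSn n) _; exact: IH.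
Qed.

Lemma event_past k x : x \in Vo -> past P F k.+1 (event k x).
Proof. by move=> xV; rewrite -[event k x]setIid; exact: events_past. Qed.

Lemma event_measurable k x : x \in Vo -> measurable (event k x).
Proof. by move=> /(event_past k) []. Qed.

Definition joint k x j v : R := pr (event k x `&` event j v).

Lemma joint_marginal k x j : x \in Vo -> \sum_(v <- Vo) joint k x j v = pr (event k x).
Proof.
move=> xV; rewrite [RHS](total_probability P (fset_uniq Vo) (Y_range j) (event_measurable k xV)) //.
by move=> v vV; apply: measurableI; exact: event_measurable.
Qed.

Lemma sum_kernel (f : 'rV[R]_d -> R) (k : R) y : y \in Vo ->
  \sum_(v <- Vo) f v * (k * (y == v)%:R + (1 - k) / m%:R) =
  k * f y + (1 - k) / m%:R * \sum_(v <- Vo) f v.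
Proof.
move=> yV; under eq_bigr do rewrite mulrDr mulrCA [f _ * (_ / _)]mulrC.
rewrite big_split /= -!mulr_sumr; congr (_ * _ + _).
rewrite (bigD1_seq y) ?fset_uniq //= eqxx mulr1 big1 ?addr0 // => v vy.
by rewrite eq_sym (negPf vy) mulr0.
Qed.

(** Repetition and uniform choice both preserve the uniform law on Vo. *)
Lemma event_law n y : y \in Vo -> pr (event n y) = m%:R^-1.
Proof.
elim/ltn_ind: n y => n IH y yV; have [n_0|n0] := posnP n.
  rewrite n_0 /pr (_ : event 0 y = [set w | X 1 w = y]) ?(first_law walk) //.
  by apply/seteqP; split=> w; rewrite /event /= /Y expr0 scale1r.
have Ej j v : (j < n)%N -> v \in Vo -> past P F n (setT `&` event j v).
  by move=> jn vV; rewrite setTI -[event j v]setIid; exact: events_past.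
have [_] := recall_decomposition n0 yV Ej; rewrite setTI => ->.
rewrite (eq_bigr (fun=> m%:R^-1)) => [|j _].
  by rewrite sumr_const card_ord -[X in _ * X]mulr_natl mulKf // pnatr_eq0 -lt0n.
rewrite sum_kernel // setTI IH // (eq_big_seq (fun=> m%:R^-1)) => [|v vV].
  rewrite big_const_seq count_predT iter_addr_0 -[X in _ / _ * X]mulr_natl.
  by rewrite mulfV ?gt_eqF // mulr1 -mulrDl addrC subrK mul1r.
by rewrite setTI IH.
Qed.

Lemma joint_diag k x v : x \in Vo -> joint k x k v = (x == v)%:R / m%:R.
Proof.
move=> xV; rewrite /joint; have [<-|xv] := eqVneq x v.
  by rewrite setIid event_law // mul1r.
by rewrite event_disjoint // /pr measure0 mul0r.
Qed.

Lemma joint_sym k x j v : joint k x j v = joint j v k x.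
Proof. by rewrite /joint setIC. Qed.

Lemma joint_rec k n x y : (k < n)%N -> x \in Vo -> y \in Vo ->
  joint k x n y = n%:R^-1 * \sum_(j < n)
    (kap n j * joint k x j y + (1 - kap n j) / m%:R / m%:R).
Proof.
move=> kn xV yV; have n0 := leq_ltn_trans (leq0n k) kn.
have [_ jointE] := recall_decomposition n0 yV
  (fun j v jn vV => events_past kn jn xV vV).
rewrite -[LHS]/(pr (event k x `&` event n y)) jointE.
congr (_ * _); apply: eq_bigr => j _.
by rewrite (sum_kernel (joint k x j)) // joint_marginal // event_law.
Qed.

(** * Covariances of the folded steps *)

Definition mu : 'rV[R]_d := m%:R^-1 *: \sum_(x <- Vo) x.

Definition dot (x y : 'rV[R]_d) : R := \sum_(i < d) x ord0 i * y ord0 i.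

Definition cov k j : R :=
  \sum_(x <- Vo) \sum_(y <- Vo) dot (x - mu) (y - mu) * joint k x j y.

Lemma dot_sym x y : dot x y = dot y x.
Proof. by apply: eq_bigr => i _; rewrite mulrC. Qed.

Lemma cov_sym k j : cov k j = cov j k.
Proof.
rewrite /cov exchange_big; apply: eq_bigr => x _; apply: eq_bigr => y _.
by rewrite dot_sym joint_sym.
Qed.

Lemma sum_centred i : \sum_(x <- Vo) (x - mu) ord0 i = 0.
Proof.
rewrite (eq_bigr (fun x : 'rV[R]_d => x ord0 i - mu ord0 i)); last first.
  by move=> x _; rewrite !mxE.
rewrite sumrB big_const_seq count_predT iter_addr_0 /mu mxE summxE.
by rewrite -[X in _ - X]mulr_natl mulVKf ?gt_eqF // subrr.
Qed.

Lemma sum_dot_centred x : \sum_(y <- Vo) dot x (y - mu) = 0.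
Proof.
rewrite exchange_big /= big1 // => i _.
by rewrite -mulr_sumr sum_centred mulr0.
Qed.

(** The uniform part of the response contributes nothing, the vectors y - mu
    having zero sum. *)
Lemma cov_rec k n : (k < n)%N ->
  cov k n = n%:R^-1 * \sum_(j < n) kap n j * cov k j.
Proof.
move=> kn; rewrite /cov.
have E x y : x \in Vo -> y \in Vo -> dot (x - mu) (y - mu) * joint k x n y =
    n%:R^-1 * \sum_(j < n) (kap n j * (dot (x - mu) (y - mu) * joint k x j y) +
     (1 - kap n j) / m%:R / m%:R * dot (x - mu) (y - mu)).
  move=> xV yV; rewrite joint_rec // mulrCA; congr (_ * _); rewrite mulr_sumr.
  by apply: eq_bigr => j _; ring.
rewrite (eq_big_seq (fun x => n%:R^-1 * \sum_(j < n) kap n j *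
    \sum_(y <- Vo) dot (x - mu) (y - mu) * joint k x j y)) => [|x xV].
  rewrite -mulr_sumr exchange_big /=; congr (_ * _).
  by apply: eq_bigr => j _; rewrite mulr_sumr.
rewrite (eq_big_seq _ (fun y yV => E x y xV yV)) -mulr_sumr exchange_big /=.
congr (_ * _); apply: eq_bigr => j _.
by rewrite big_split /= -!mulr_sumr sum_dot_centred mulr0 addr0.
Qed.

(** The variance of the uniform law on Vo. *)
Definition sigma2 : R := m%:R^-1 * \sum_(x <- Vo) dot (x - mu) (x - mu).

Lemma cov_diag k : cov k k = sigma2.
Proof.
rewrite /cov /sigma2 mulr_sumr; apply: eq_big_seq => x xV.
rewrite (bigD1_seq x) ?fset_uniq //= big1 => [|y yx].
  by rewrite joint_diag // eqxx mul1r addr0 mulrC.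
by rewrite joint_diag // eq_sym (negPf yx) mul0r mulr0.
Qed.

Lemma sigma2_gt0 : 0 < sigma2.
Proof.
have dot_ge0 x : 0 <= dot x x by apply: sumr_ge0 => i _; rewrite -expr2 sqr_ge0.
rewrite /sigma2 mulr_gt0 ?invr_gt0 // lt_neqAle eq_sym.
rewrite sumr_ge0 ?andbT => [|x _]; last exact: dot_ge0.
apply/negP => /eqP sum0.
have Vmu x : x \in Vo -> x = mu.
  move=> xV; have : dot (x - mu) (x - mu) = 0.
    apply/eqP; rewrite eq_le dot_ge0 andbT -sum0 (bigD1_seq x) ?fset_uniq //=.
    by rewrite lerDl sumr_ge0.
  move/eqP; rewrite psumr_eq0 => [/allP h|i _]; last by rewrite -expr2 sqr_ge0.
  apply/rowP => i; apply/eqP; have := h i (mem_index_enum i).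
  by rewrite /= mulf_eq0 orbb [(x - mu) _ _]mxE [(- mu) _ _]mxE subr_eq0.
move: m_ge2; rewrite leqNgt ltnS => /negP; apply.
have : (Vo `<=` [fset mu])%fset.
  by apply/fsubsetP => x /Vmu ->; rewrite in_fset1.
by move/fsubset_leq_card; rewrite cardfs1.
Qed.

Lemma has_mean_pair (phi : 'rV[R]_d -> 'rV[R]_d -> R) k j :
  has_mean P (fun w => phi (Y k w) (Y j w))
    (\sum_(x <- Vo) \sum_(y <- Vo) phi x y * joint k x j y).
Proof.
have ind x : x \in Vo -> has_mean P
    (fun w => \sum_(y <- Vo) phi x y * \1_(event k x `&` event j y) w)
    (\sum_(y <- Vo) phi x y * joint k x j y).
  move=> xV; apply: has_mean_sum => y yV; apply: has_meanZ; apply: has_mean_indic.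
  by apply: measurableI; exact: event_measurable.
apply: has_mean_ext (has_mean_sum ind) => w.
rewrite (bigD1_seq (Y k w)) ?fset_uniq ?Y_range //=.
rewrite (bigD1_seq (Y j w)) ?fset_uniq ?Y_range //=.
rewrite indicE mem_set // mulr1 !big1 ?addr0 // => [x xY|y yY].
  by rewrite big1 // => y _; rewrite indicE memNset ?mulr0 // => -[/eqP h _]; rewrite eq_sym h in xY.
by rewrite indicE memNset ?mulr0 // => -[_ /eqP h]; rewrite eq_sym h in yY.
Qed.

Lemma has_mean_coord k i : has_mean P (fun w => Y k w ord0 i) (mu ord0 i).
Proof.
have := has_mean_pair (fun x _ => x ord0 i) k k.
rewrite (_ : \sum_(x <- Vo) _ = mu ord0 i) //.
rewrite /mu mxE summxE mulr_sumr; apply: eq_big_seq => x xV.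
by rewrite -mulr_sumr joint_marginal // event_law // mulrC.
Qed.

(** Weighted sums of folded steps cover both a single step and the walk. *)
Lemma mean_sq_dev_sum (t : nat -> R) n (Z : T -> 'rV[R]_d) :
  (forall w, Z w = \sum_(k < n) t k *: Y k w) ->
  mean_sq_dev P Z = \sum_(k < n) \sum_(j < n) t k * t j * cov k j.
Proof.
move=> ZE.
have mZ : mean_vec P Z = (\sum_(k < n) t k) *: mu.
  apply/rowP => i; rewrite [LHS]mxE [RHS]mxE.
  have [_ h] : has_mean P (fun w => Z w ord0 i) (\sum_(k < n) t k * mu ord0 i).
    apply: (@has_mean_ext _ _ _ _ (fun w => \sum_(k < n) t k * Y k w ord0 i)).
      by move=> w; rewrite ZE summxE; apply: eq_bigr => k _; rewrite [RHS]mxE.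
    by apply: has_mean_sum => k _; apply: has_meanZ; exact: has_mean_coord.
  by rewrite h /= mulr_suml.
have [_ h] : has_mean P (fun w => enorm (Z w - mean_vec P Z) ^+ 2)
    (\sum_(k < n) \sum_(j < n) t k * t j * cov k j).
  apply: (@has_mean_ext _ _ _ _ (fun w => \sum_(k < n) \sum_(j < n)
      t k * t j * dot (Y k w - mu) (Y j w - mu))).
    move=> w; rewrite /enorm sqr_sqrtr; last by apply: sumr_ge0 => i _; exact: sqr_ge0.
    have Zi i : (Z w - mean_vec P Z) ord0 i = \sum_(k < n) t k * (Y k w - mu) ord0 i.
      rewrite mZ ZE !mxE summxE mulr_suml -sumrB; apply: eq_bigr => k _.
      by rewrite !mxE mulrBr.
    under [RHS]eq_bigr do rewrite Zi expr2 big_distrlr /=.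
    rewrite [RHS]exchange_big; apply: eq_bigr => k _.
    rewrite [RHS]exchange_big; apply: eq_bigr => j _.
    by rewrite /dot mulr_sumr; apply: eq_bigr => i _; ring.
  apply: has_mean_sum => k _; apply: has_mean_sum => j _; apply: has_meanZ.
  exact: (has_mean_pair (fun x y => dot (x - mu) (y - mu))).
by rewrite /mean_sq_dev h.
Qed.

Lemma mean_sq_dev_step n : mean_sq_dev P (X n.+1) = sigma2.
Proof.
(* A single step is a sum with one nonzero weight. *)
pose t k : R := if k == n then sgn n else 0.
rewrite (@mean_sq_dev_sum t n.+1) => [|w].
  rewrite big_ord_recr /= big1 ?add0r => [|k _].
    rewrite big_ord_recr /= big1 ?add0r => [|j _].
      by rewrite /t eqxx -expr2 sqrr_sign mul1r cov_diag.
    by rewrite /t (ltn_eqF (ltn_ord j)) mulr0 mul0r.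
  by rewrite big1 // => j _; rewrite /t (ltn_eqF (ltn_ord k)) !mul0r.
rewrite big_ord_recr /= big1 ?add0r => [|k _]; first by rewrite /t eqxx -XY.
by rewrite /t (ltn_eqF (ltn_ord k)) scale0r.
Qed.

(** The expected inner product of the weighted sums of the centred folded steps,
    with weights s and t. *)
Definition moment (s t : nat -> R) n : R :=
  \sum_(k < n) \sum_(j < n) s k * t j * cov k j.

Lemma mean_sq_dev_walk n :
  mean_sq_dev P (elephant_walk X n) = moment (fun k => sgn k) (fun k => sgn k) n.
Proof.
apply: mean_sq_dev_sum => w; elim: n => [|n IH] /=; first by rewrite big_ord0.
by rewrite big_ord_recr /= IH -XY.
Qed.

Lemma mean_sq_dev_ge0 (Z : T -> 'rV[R]_d) : 0 <= mean_sq_dev P Z.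
Proof. by apply/fine_ge0/expectation_ge0 => w; exact: sqr_ge0. Qed.

Lemma moment_sym s t n : moment s t n = moment t s n.
Proof.
rewrite /moment exchange_big; apply: eq_bigr => k _; apply: eq_bigr => j _.
by rewrite cov_sym [s _ * _]mulrC.
Qed.

Lemma momentS s t n : (0 < n)%N -> moment s t n.+1 = moment s t n
  + t n * (n%:R^-1 * (gam * moment s (fun=> 1) n + del * sgn n * moment s (fun k => sgn k) n))
  + s n * (n%:R^-1 * (gam * moment t (fun=> 1) n + del * sgn n * moment t (fun k => sgn k) n))
  + s n * t n * sigma2.
Proof.
move=> n0.
have new (u : nat -> R) : \sum_(k < n) u k * cov k n =
    n%:R^-1 * (gam * moment u (fun=> 1) n + del * sgn n * moment u (fun k => sgn k) n).
  rewrite /moment !mulr_sumr -big_split mulr_sumr /=; apply: eq_bigr => k _.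
  rewrite cov_rec // mulrCA; congr (_ * _).
  rewrite !mulr_sumr -big_split /=; apply: eq_bigr => j _.
  by rewrite /kap; ring.
rewrite {1}/moment big_ord_recr /= big_ord_recr /= cov_diag.
under eq_bigr do rewrite big_ord_recr /=.
rewrite big_split /= -/(moment s t n) -!new.
have -> : \sum_(k < n) s k * t n * cov k n = t n * \sum_(k < n) s k * cov k n.
  by rewrite mulr_sumr; apply: eq_bigr => k _; ring.
have -> : \sum_(k < n) s n * t k * cov n k = s n * \sum_(k < n) t k * cov k n.
  by rewrite mulr_sumr; apply: eq_bigr => k _; rewrite cov_sym; ring.
by rewrite !addrA.
Qed.

Lemma moments_covariance_recursion :
  covariance_recursion gam del sigma2
    (moment (fun k => sgn k) (fun k => sgn k)) (moment (fun=> 1) (fun=> 1))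
    (moment (fun k => sgn k) (fun=> 1)).
Proof.
have sgn2 n : sgn n * sgn n = 1 :> R by rewrite -expr2 sqrr_sign.
split; try by rewrite /moment !big_ord1 cov_diag ?expr0 !mul1r.
move=> n n0; have n0' : n%:R != 0 :> R by rewrite pnatr_eq0 -lt0n.
have sym := moment_sym (fun=> 1) (fun k => sgn k) n.
rewrite !momentS // sym; have := sgn2 n; move: (sgn n) => e e2.
move: (moment (fun k => sgn k) (fun k => sgn k) n) (moment (fun=> 1) (fun=> 1) n)
  (moment (fun k => sgn k) (fun=> 1) n) => a b c.
split.
- have -> : e * (n%:R^-1 * (gam * c + del * e * a)) =
    n%:R^-1 * (e * gam * c + del * (e * e) * a) by ring.
  by rewrite e2; ring.
- by ring.
- have -> : e * (n%:R^-1 * (gam * b + del * e * c)) =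
    n%:R^-1 * (e * gam * b + del * (e * e) * c) by ring.
  by rewrite e2; ring.
Qed.
End Law.

(** * The supercritical constant *)

Section Constants.
Context {R : realType}.
Implicit Types (gam del r : R) (a b c f : nat -> R).

Lemma memory_coef_le1 (m : nat) r : (2 <= m)%N -> 0 <= r <= 1 ->
  `|memory_coef m r| <= 1.
Proof.
move=> m2 /andP[r0 r1]; have m2' : 2 <= m%:R :> R by rewrite ler_nat.
have m1 : 0 < m%:R - 1 :> R by lra.
have mr0 : 0 <= m%:R * r by rewrite mulr_ge0.
have mr1 : m%:R * r <= m%:R by rewrite ler_piMr.
by rewrite ler_norml ler_pdivlMr // ler_pdivrMr //; apply/andP; split; lra.
Qed.

Lemma half_sum_diff_le1 (x y : R) : `|x| <= 1 -> `|y| <= 1 ->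
  `|(x + y) / 2| + `|(x - y) / 2| <= 1.
Proof.
rewrite !ler_norml => /andP[? ?] /andP[? ?].
by case: (ler0P ((x + y) / 2)); case: (ler0P ((x - y) / 2)); lra.
Qed.

Lemma covariance_recursion_unique gam del s2 a b c a' b' c' :
  covariance_recursion gam del s2 a b c ->
  covariance_recursion gam del s2 a' b' c' ->
  forall n, (0 < n)%N -> [/\ a n = a' n, b n = b' n & c n = c' n].
Proof.
move=> [a1 b1 c1 rec] [a1' b1' c1' rec']; elim=> // n IH _.
have [->|n0] := posnP n; first by rewrite a1 b1 c1 a1' b1' c1'.
have [-> -> ->] := rec n n0; have [-> -> ->] := rec' n n0.
by have [-> -> ->] := IH n0.
Qed.

(** The limit of the recursion in the supercritical regime.  Characterising it
    by the recursion alone makes it independent of the probability space. *)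
Definition supercritical_limit gam del s2 : set R :=
  [set C : R | 0 < C /\ forall a b c, covariance_recursion gam del s2 a b c ->
    a n / n%:R `^ (2 * del) @[n --> \oo] --> C].

Lemma supercritical_limit_nonempty gam del s2 a b c :
  0 < s2 -> `|gam| + `|del| <= 1 -> gam < 1 -> del < 1 -> 1 / 2 < del ->
  covariance_recursion gam del s2 a b c -> (forall n, 0 <= a n) ->
  exists C, supercritical_limit gam del s2 C.
Proof.
move=> s20 gd gam1 del1 del12 rec a0.
have [C C0 aC] := moment_supercritical s20 gd rec gam1 del1 a0 del12.
exists C; split=> // a' b' c' rec'; move: aC.
apply: cvg_trans; apply: near_eq_cvg; near=> n.
have n0 : (0 < n)%N by near: n; exact: nbhs_infty_gt.
by have [-> _ _] := covariance_recursion_unique rec rec' n0.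
Unshelve. all: by end_near. Qed.

Lemma asymp_equiv_of_cvg a f (K : R) : K != 0 ->
  a n / f n @[n --> \oo] --> K -> asymp_equiv a (fun n => K * f n).
Proof.
move=> K0 aK; rewrite /asymp_equiv -(divff K0).
have : a n / f n * K^-1 @[n --> \oo] --> K / K by apply: cvgM => //; exact: cvg_cst.
by under eq_fun do rewrite -mulrA -invfM [f _ * K]mulrC.
Qed.

End Constants.

Theorem theorem2p12 (R : realType) (d : nat) (Se So : set 'rV[R]_d)
    (Ve Vo : {fset 'rV[R]_d}) (m : nat) :
  (1 <= d)%N -> step_system Se So Ve Vo -> #|` Vo| = m -> (2 <= m)%N ->
  exists C : R -> R -> R,
  forall p q : R, 0 <= p <= 1 -> 0 <= q <= 1 ->
  let alpha := memory_coef m p in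
  let beta := memory_coef m q in
  let gamma := (alpha + beta) / 2 in
  let delta := (alpha - beta) / 2 in
  gamma < 1 -> delta < 1 ->
  0 < C alpha beta /\
  exists sigma2 : R, 0 < sigma2 /\
  forall (disp : measure_display) (T : measurableType disp)
    (P : probability T R) (X : nat -> T -> 'rV[R]_d) (U : nat -> T -> nat)
    (G : nat -> 'rV[R]_d -> T -> 'rV[R]_d),
  elephant_steps Ve Vo p q P X U G ->
  let S := elephant_walk X in
  [/\ mean_sq_dev P (X n) @[n --> \oo] --> sigma2,
      delta < 1 / 2 -> asymp_equiv (fun n => mean_sq_dev P (S n))
        (fun n => sigma2 / (1 - 2 * delta) * n%:R),
      delta = 1 / 2 -> asymp_equiv (fun n => mean_sq_dev P (S n))
        (fun n => sigma2 * n%:R * ln n%:R)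
    & 1 / 2 < delta -> delta < 1 -> asymp_equiv (fun n => mean_sq_dev P (S n))
        (fun n => C alpha beta * n%:R `^ (2 * delta))].
Proof.
move=> _ steps <-{m} m2; pose s2 := sigma2 Vo.
have s20 : 0 < s2 := sigma2_gt0 m2.
pose lims (alpha beta : R) :=
  supercritical_limit ((alpha + beta) / 2) ((alpha - beta) / 2) s2.
exists (fun alpha beta => xget 1 (lims alpha beta)) => p q p01 q01.
move=> alpha beta gamma delta gam1 del1; split.
  by case: xgetP => [C _ []|_].
exists s2; split=> // disp T P X U G walk S.
have gd : `|gamma| + `|delta| <= 1.
  by apply: half_sum_diff_le1; exact: memory_coef_le1.
have rec := moments_covariance_recursion steps m2 walk.
have walkE := mean_sq_dev_walk steps m2 walk.
have dev_cvg f (L : R) : moment Vo P X (fun k => (-1) ^+ k) (fun k => (-1) ^+ k) n / f n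
    @[n --> \oo] --> L -> mean_sq_dev P (S n) / f n @[n --> \oo] --> L.
  by under eq_fun do rewrite -walkE.
split.
- rewrite -cvg_shiftS /=; under eq_fun do rewrite (mean_sq_dev_step steps m2 walk).
  exact: cvg_cst.
- move=> del12; apply: asymp_equiv_of_cvg.
    by rewrite gt_eqF // divr_gt0 //; lra.
  by apply: dev_cvg; exact: moment_linear rec gam1 del1 del12.
- move=> del12; under [X in asymp_equiv _ X]eq_fun do rewrite -mulrA.
  apply: asymp_equiv_of_cvg; first by rewrite gt_eqF.
  by apply: dev_cvg; exact: moment_critical rec gam1 del1 del12.
- move=> del12 _.
  have [|C limC] := supercritical_limit_nonempty s20 gd gam1 del1 del12 rec.
    by move=> n; rewrite -walkE; exact: mean_sq_dev_ge0.
  have [xC0 xC] := xgetPex 1 (ex_intro _ C limC).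
  apply: asymp_equiv_of_cvg; first by rewrite gt_eqF.
  by apply: dev_cvg; exact: xC rec.
Qed.
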